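(* Let $a,b,c\in\mathbb{R}$ with $0<2|ab|<1$, let $\mathcal{G}=\mathcal{G}_{a,b,c}\subset\mathrm{SOL}$ be the corresponding Grayson cylinder, and let $\xi,\eta$ be the vector fields on $\mathrm{SOL}$ defined by $$\xi=a e^{2z}\frac{\partial}{\partial x}+b e^{-2z}\frac{\partial}{\partial y}+(c-ax+by)\frac{\partial}{\partial z},\qquad \eta=b\frac{\partial}{\partial x}+a\frac{\partial}{\partial y}.$$ Then: (i) At every point of $\mathcal{G}_{a,b,c}$ the vectors $\xi$ and $\eta$ are tangent to $\mathcal{G}_{a,b,c}$. (ii) Any integral curve of $\xi$ through a point of $\mathcal{G}_{a,b,c}$ is a geodesic of $\mathrm{SOL}$. In particular it is globally contained in $\mathcal{G}_{a,b,c}$. (iii) The integral curves of $\eta$ (through points of $\mathcal{G}_{a,b,c}$) are horizontal lines contained in $\mathcal{G}_{a,b,c}$ and parallel to the cylinder's axis. They are geodesics precisely along the two inflection lines. (iv) The flows generated by $\xi$ and $\eta$ commute; both leave the Grayson cylinder invariant. (v) At any point of the Grayson cylinder we have $$2|ab|\le|\cos\theta|\le\sqrt{2|ab|}<1,$$ where $\theta$ is the Riemannian angle between $\xi$ and $\eta$. In particular $\theta$ is uniformly separated from $0$, $\pi/2$ and $\pi$ by constants that depend only on $a,b$. (vi) The sign of $\cos\theta$ is the sign of $ab$. Its absolute value attains its minimum (over $\mathcal{G}_{a,b,c}$) along the critical lines (where $ax-by=c$) and its maximum along the inflection lines (where $z=h$) of $\mathcal{G}_{a,b,c}$. (vii)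 Any isometry of $\mathrm{SOL}$ fixing the cylinder's axis and its direction preserves both $\mathcal{G}$ and the vector fields $\xi,\eta$.
   Context: $\mathrm{SOL}$ is $\mathbb{R}^3$ with coordinates $(x,y,z)$ and the Riemannian metric $ds^2=e^{-2z}dx^2+e^{2z}dy^2+dz^2$. For $a,b,c\in\mathbb{R}$ with $0<2|ab|<1$, the *Grayson cylinder* is $$\mathcal{G}_{a,b,c}=\{(x,y,z)\in\mathrm{SOL}\;:\;(ax-by-c)^2+a^2e^{2z}+b^2e^{-2z}=1\}.$$ Put $h=\frac12\log|b/a|$, $k=\sqrt{\frac{1-2|ab|}{1+2|ab|}}$, and $A(k)=\operatorname{arctanh}(k)$. The *axis* of $\mathcal{G}_{a,b,c}$ is the horizontal line $\{z=h,\ ax-by=c\}$ (it is directed by the vector $(b,a,0)$; ''fixing the axis and its direction'' means mapping the axis to itself and preserving its orientation). The *inflection lines* are the two horizontal lines $\{z=h,\ ax-by=c\pm\sqrt{1-2|ab|}\}$. The *critical lines* are the two horizontal lines $\{z-h=\pm A(k),\ ax-by=c\}$. All four of these inflection and critical lines lie on $\mathcal{G}_{a,b,c}$. *)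

(* Defs.v *)
From Stdlib Require Import Reals Lra.
From Coquelicot Require Import Coquelicot.
Open Scope R_scope.

(** * Coordinates on R^3

    Points of R^3 and tangent vectors at a point are both triples: a vector is
    given by its components in the frame d/dx, d/dy, d/dz. *)

Definition R3 : Type := (R * R * R)%type.

Inductive axis3 : Set := Ix | Iy | Iz.

Definition coord (p : R3) (i : axis3) : R :=
  let '(x, y, z) := p in
  match i with Ix => x | Iy => y | Iz => z end.

Definition upd (p : R3) (i : axis3) (s : R) : R3 :=
  let '(x, y, z) := p in
  match i with Ix => (s, y, z) | Iy => (x, s, z) | Iz => (x, y, s) end.

Definition sum3 (f : axis3 -> R) : R := f Ix + f Iy + f Iz.

Definition vadd (p v : R3) : R3 :=
  (coord p Ix + coord v Ix, coord p Iy + coord v Iy, coord p Iz + coord v Iz).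

Definition vscale (s : R) (v : R3) : R3 :=
  (s * coord v Ix, s * coord v Iy, s * coord v Iz).

Definition vzero : R3 := (0, 0, 0).

Definition subset (A B : R3 -> Prop) : Prop := forall p, A p -> B p.

Definition set_eq (A B : R3 -> Prop) : Prop := forall p, A p <-> B p.

Definition image (f : R3 -> R3) (A : R3 -> Prop) : R3 -> Prop :=
  fun q => exists p, A p /\ f p = q.

Definition line (p v : R3) : R3 -> Prop :=
  fun q => exists s : R, q = vadd p (vscale s v).

Definition horizontal_line (L : R3 -> Prop) : Prop :=
  exists p v, v <> vzero /\ coord v Iz = 0 /\ set_eq L (line p v).

Definition parallel_lines (L M : R3 -> Prop) : Prop :=
  exists p q v, v <> vzero /\ set_eq L (line p v) /\ set_eq M (line q v).

(** * Differential calculus on R^3 *)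

Definition ex_partial (i : axis3) (f : R3 -> R) (p : R3) : Prop :=
  ex_derive (fun s => f (upd p i s)) (coord p i).

Definition partial (i : axis3) (f : R3 -> R) (p : R3) : R :=
  Derive (fun s => f (upd p i s)) (coord p i).

Fixpoint class_C (n : nat) (f : R3 -> R) : Prop :=
  match n with
  | O => forall p, continuous f p
  | S m => (forall p, continuous f p) /\
           forall i, (forall p, ex_partial i f p) /\ class_C m (partial i f)
  end.

Definition smooth (phi : R3 -> R3) : Prop :=
  forall n i, class_C n (fun p => coord (phi p) i).

Definition diffeomorphism (phi : R3 -> R3) : Prop :=
  smooth phi /\
  exists psi : R3 -> R3, smooth psi /\
    (forall p, psi (phi p) = p) /\ (forall q, phi (psi q) = q).

(** The differential of [phi] at [p], applied to [v] (Jacobian matrix times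
    [v]); only used for smooth [phi]. *)
Definition differential (phi : R3 -> R3) (p v : R3) : R3 :=
  let d k := sum3 (fun i => partial i (fun q => coord (phi q) k) p * coord v i) in
  (d Ix, d Iy, d Iz).

Definition velocity (gam : R -> R3) (t : R) (v : R3) : Prop :=
  forall i, is_derive (fun s => coord (gam s) i) t (coord v i).

(** [v] belongs to the tangent space at [p] of the surface [S]: it is the
    velocity at [p] of a C^1 curve drawn on [S]. *)
Definition tangent_to (S : R3 -> Prop) (p v : R3) : Prop :=
  exists (gam : R -> R3) (eps : R),
    0 < eps /\
    gam 0 = p /\ velocity gam 0 v /\
    forall t, Rabs t < eps ->
      S (gam t) /\
      forall i, ex_derive (fun s => coord (gam s) i) t /\
                continuous (Derive (fun s => coord (gam s) i)) t.

(** * Integral curves and flows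

    The endpoints of intervals lie in [Rbar], so that [m_infty], [p_infty]
    give the whole real line. *)

Definition in_interval (al be : Rbar) (t : R) : Prop :=
  Rbar_lt al t /\ Rbar_lt t be.

Definition trajectory (gam : R -> R3) : R3 -> Prop :=
  fun q => exists t, gam t = q.

Definition integral_curve (V : R3 -> R3) (al be : Rbar) (gam : R -> R3) : Prop :=
  forall t, in_interval al be t -> velocity gam t (V (gam t)).

Definition is_flow (V : R3 -> R3) (Phi : R -> R3 -> R3) : Prop :=
  forall p, Phi 0 p = p /\ integral_curve V m_infty p_infty (fun t => Phi t p).

(** * Riemannian geometry in global coordinates

    [g p i j] is the Gram matrix of a metric in the coordinate frame and
    [ginv p] is its inverse matrix. *)

Definition tensor2 : Type := R3 -> axis3 -> axis3 -> R.

Definition inner (g : tensor2) (p v w : R3) : R :=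
  sum3 (fun i => sum3 (fun j => g p i j * coord v i * coord w j)).

Definition rnorm (g : tensor2) (p v : R3) : R := sqrt (inner g p v v).

Definition angle (g : tensor2) (p v w : R3) : R :=
  acos (inner g p v w / (rnorm g p v * rnorm g p w)).

(** [christoffel g ginv p k i j] is Gamma^k_{ij} at [p]. *)
Definition christoffel (g ginv : tensor2) (p : R3) (k i j : axis3) : R :=
  / 2 * sum3 (fun l => ginv p k l *
    (partial i (fun q => g q j l) p + partial j (fun q => g q i l) p
     - partial l (fun q => g q i j) p)).

(** Affinely parametrized geodesics on an open interval. *)
Definition geodesic (g ginv : tensor2) (al be : Rbar) (gam : R -> R3) : Prop :=
  let x k := fun s => coord (gam s) k in
  forall t, in_interval al be t -> forall k,
    ex_derive (x k) t /\ ex_derive (Derive (x k)) t /\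
    Derive (Derive (x k)) t
    + sum3 (fun i => sum3 (fun j =>
        christoffel g ginv (gam t) k i j * Derive (x i) t * Derive (x j) t)) = 0.

Definition isometry (g : tensor2) (phi : R3 -> R3) : Prop :=
  diffeomorphism phi /\
  forall p v w,
    inner g (phi p) (differential phi p v) (differential phi p w) = inner g p v w.

(** * SOL *)

Definition sol_metric : tensor2 := fun p i j =>
  match i, j with
  | Ix, Ix => exp (- 2 * coord p Iz)
  | Iy, Iy => exp (2 * coord p Iz)
  | Iz, Iz => 1
  | _, _ => 0
  end.

Definition sol_cometric : tensor2 := fun p i j =>
  match i, j with
  | Ix, Ix => exp (2 * coord p Iz)
  | Iy, Iy => exp (- 2 * coord p Iz)
  | Iz, Iz => 1
  | _, _ => 0
  end.

Lemma sol_cometric_inverse (p : R3) (i k : axis3) :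
  sum3 (fun j => sol_metric p i j * sol_cometric p j k) =
  match i, k with Ix, Ix | Iy, Iy | Iz, Iz => 1 | _, _ => 0 end.
Proof.
  destruct i, k; unfold sum3, sol_metric, sol_cometric;
    rewrite ?Rmult_0_l, ?Rmult_0_r, ?Rplus_0_l, ?Rplus_0_r, ?Rmult_1_r;
    try reflexivity; rewrite <- exp_plus, <- exp_0; f_equal; lra.
Qed.

Definition sol_geodesic (al be : Rbar) (gam : R -> R3) : Prop :=
  geodesic sol_metric sol_cometric al be gam.

Definition sol_isometry (phi : R3 -> R3) : Prop := isometry sol_metric phi.

Definition sol_angle (p v w : R3) : R := angle sol_metric p v w.

(** * Grayson cylinders *)

Definition grayson (a b c : R) : R3 -> Prop := fun '(x, y, z) =>
  (a * x - b * y - c) ^ 2 + a ^ 2 * exp (2 * z) + b ^ 2 * exp (- 2 * z) = 1.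

Definition grayson_h (a b : R) : R := / 2 * ln (Rabs (b / a)).

Definition grayson_k (a b : R) : R :=
  sqrt ((1 - 2 * Rabs (a * b)) / (1 + 2 * Rabs (a * b))).

Definition arctanh (x : R) : R := / 2 * ln ((1 + x) / (1 - x)).

Definition axis_direction (a b : R) : R3 := (b, a, 0).

Definition axis_line (a b c : R) : R3 -> Prop := fun '(x, y, z) =>
  z = grayson_h a b /\ a * x - b * y = c.

Definition inflection_line_plus (a b c : R) : R3 -> Prop := fun '(x, y, z) =>
  z = grayson_h a b /\ a * x - b * y = c + sqrt (1 - 2 * Rabs (a * b)).

Definition inflection_line_minus (a b c : R) : R3 -> Prop := fun '(x, y, z) =>
  z = grayson_h a b /\ a * x - b * y = c - sqrt (1 - 2 * Rabs (a * b)).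

Definition inflection_lines (a b c : R) : R3 -> Prop := fun p =>
  inflection_line_plus a b c p \/ inflection_line_minus a b c p.

Definition critical_lines (a b c : R) : R3 -> Prop := fun '(x, y, z) =>
  (z - grayson_h a b = arctanh (grayson_k a b) \/
   z - grayson_h a b = - arctanh (grayson_k a b)) /\
  a * x - b * y = c.

Definition xi (a b c : R) : R3 -> R3 := fun '(x, y, z) =>
  (a * exp (2 * z), b * exp (- 2 * z), c - a * x + b * y).

Definition eta (a b : R) : R3 -> R3 := fun _ => (b, a, 0).

Definition fixes_axis_and_direction (a b c : R) (phi : R3 -> R3) : Prop :=
  set_eq (image phi (axis_line a b c)) (axis_line a b c) /\
  forall p, axis_line a b c p ->
    exists lam, 0 < lam /\
      differential phi p (axis_direction a b) = vscale lam (axis_direction a b).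

Definition preserves_field (phi : R3 -> R3) (V : R3 -> R3) : Prop :=
  forall p, differential phi p (V p) = V (phi p).

(* Main.v *)
Require Import Defs.
From Stdlib Require Import Reals.
From Coquelicot Require Import Coquelicot.
From Stdlib Require Import Lra ClassicalEpsilon.
Open Scope R_scope.

(** Put u = ax - by - c. The equation of the cylinder is the level 1 of the function
    u^2 + a^2 exp (2 z) + b^2 exp (- 2 z), and along [xi] one has z' = - u and
    u' = a^2 exp (2 z) - b^2 exp (- 2 z), so that this function is conserved
    ([energy_conserved]). Differentiating once more, integral curves of [xi] satisfy the
    geodesic equation ([geodesic_xi]). The field [eta] generates the translations along the
    axis, which do not change u and z and hence preserve the cylinder and [xi]. Tangency
    follows from integral curves that stay on the cylinder.

    The flow of [xi] must exist for all times. The (u, z)-system is integrated by a phase: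
    u = m sin f and |a| exp z - |b| exp (- z) = m cos f reduce it to a scalar equation
    f' = S f with S between two positive constants, which is solved by inverting a primitive
    of 1 / S ([autonomous_ode], [xi_integral_curve_exists]). Uniqueness comes from a Gronwall
    estimate in variables in which the system is polynomial ([xi_integral_curve_unique]);
    it implies that the flows commute and that the time t map is bijective.

    On the cylinder [xi] has length 1, its scalar product with [eta] is 2ab, and the squared
    length N of [eta] depends on z only and equals 1 - u^2, whence
    cos theta = 2ab / sqrt N ([cos_angle_formula]). At height h + w one has
    N = 2 |ab| cosh (2 w), so that N runs between 2 |ab|, reached where z = h, and 1,
    reached where u = 0. The same formula shows when an integral curve of [eta] is a
    geodesic: its acceleration vanishes exactly where N is minimal.

    For the isometries, the full isometry group of SOL is determined
    ([sol_isometry_classification]). An isometry preserves the Levi-Civita connection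
    ([hess_christoffel]), hence pulls the Killing fields d/dx and d/dy back to Killing fields
    ([pullback_field_killing]). Killing's equation on SOL is solved by separating powers of
    exp (2 z) ([killing_fields_sol]), and comparing the lengths of the pulled back fields with
    those of d/dx and d/dy forces the isometry to be affine in x, y, z of one of two explicit
    shapes. Those that fix the axis with its direction visibly preserve the cylinder and both
    fields ([isometry_preserves_grayson]). *)

(** * Calculus in coordinates *)

Lemma in_interval_between al be s t r :
  in_interval al be s -> in_interval al be t -> s <= r <= t -> in_interval al be r.
Proof.
  intros [H1 _] [_ H2] [Hs Ht]. split.
  - apply (Rbar_lt_le_trans al s r H1 Hs).
  - apply (Rbar_le_lt_trans r t be Ht H2).
Qed.

Lemma in_interval_line t : in_interval m_infty p_infty t.
Proof. split; exact I. Qed.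

Lemma locally_in_interval al be t :
  in_interval al be t -> locally t (fun s => in_interval al be s).
Proof.
  intros [H1 H2]. apply filter_and.
  - destruct al as [r | |]; [apply (open_gt r t H1) | contradiction H1 |].
    now apply filter_forall.
  - destruct be as [r | |]; [apply (open_lt r t H2) | | contradiction H2].
    now apply filter_forall.
Qed.

Lemma is_derive_zero_interval al be (f : R -> R) :
  (forall t, in_interval al be t -> is_derive f t 0) ->
  forall s t, in_interval al be s -> in_interval al be t -> f s = f t.
Proof.
  intros Hf.
  assert (key : forall s t, in_interval al be s -> in_interval al be t -> s < t -> f s = f t).
  { intros s t Hs Ht Hst. apply eq_is_derive; [| exact Hst].
    intros r Hr. apply Hf, (in_interval_between al be s t r Hs Ht Hr). }
  intros s t Hs Ht. destruct (Rtotal_order s t) as [Hst | [-> | Hst]];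
    [now apply key | reflexivity | symmetry; now apply key].
Qed.

Lemma is_derive_zero_const (f : R -> R) :
  (forall t, is_derive f t 0) -> forall s t, f s = f t.
Proof.
  intros Hf s t.
  apply (is_derive_zero_interval m_infty p_infty f); auto using in_interval_line.
Qed.

Lemma nonneg_derive_le (f df : R -> R) :
  (forall t, is_derive f t (df t)) -> (forall t, 0 <= df t) ->
  forall s t, s <= t -> f s <= f t.
Proof.
  intros Hf Hdf s t Hst.
  destruct (MVT_gen f s t df) as (r & _ & Hr).
  - intros x _. apply Hf.
  - intros x _. apply continuity_pt_filterlim, (ex_derive_continuous f).
    exists (df x). apply Hf.
  - pose proof (Hdf r). nra.
Qed.

Lemma is_derive_exp_scale (f : R -> R) (t l c : R) :
  is_derive f t l -> is_derive (fun s => exp (c * f s)) t (l * (c * exp (c * f t))).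
Proof.
  intros Hf. auto_derive.
  - exists l; exact Hf.
  - rewrite (is_derive_unique f t l Hf : Derive (fun x => f x) t = l). ring.
Qed.

Lemma is_derive_prod3 (f g h : R -> R) (t df dg dh F G K : R) :
  is_derive f t df -> is_derive g t dg -> is_derive h t dh ->
  (F = f t /\ G = g t /\ K = h t) ->
  is_derive (fun s => f s * (g s * h s)) t (df * (G * K) + F * (dg * K + G * dh)).
Proof.
  intros Hf Hg Hh (-> & -> & ->). auto_derive.
  - repeat split; eexists; eassumption.
  - rewrite (is_derive_unique f t df Hf : Derive (fun x => f x) t = df), (is_derive_unique g t dg Hg : Derive (fun x => g x) t = dg),
      (is_derive_unique h t dh Hh : Derive (fun x => h x) t = dh). ring.
Qed.

Lemma coord_ext (p q : R3) : (forall i, coord p i = coord q i) -> p = q.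
Proof.
  intros H. generalize (H Ix), (H Iy), (H Iz).
  destruct p as [[x y] z], q as [[x' y'] z']. simpl. congruence.
Qed.

Lemma upd_upd p i s t : upd (upd p i s) i t = upd p i t.
Proof. destruct p as [[x y] z], i; reflexivity. Qed.

Lemma coord_upd p i s : coord (upd p i s) i = s.
Proof. destruct p as [[x y] z], i; reflexivity. Qed.

Lemma upd_coord p i : upd p i (coord p i) = p.
Proof. destruct p as [[x y] z], i; reflexivity. Qed.

Lemma is_derive_partial (f : R3 -> R) p i :
  ex_partial i f p ->
  is_derive (fun s => f (upd p i s)) (coord p i) (partial i f p).
Proof. apply Derive_correct. Qed.

Lemma continuous_slice2 (F : R3 -> R) (i j : axis3) (p : R3) (u v : R) :
  (forall q, continuous F q) ->
  continuity_2d_pt (fun u v => F (upd (upd p i u) j v)) u v.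
Proof.
  intros HF eps.
  set (q := upd (upd p i u) j v).
  destruct (HF q (fun y => Rabs (y - F q) < eps)) as [d Hd].
  { exists eps. intros y Hy. exact Hy. }
  exists d. intros u' v' Hu Hv. apply Hd. unfold q.
  pose proof (cond_pos d) as Hpos.
  assert (Hc : forall w : R, ball w d w) by (intros; apply ball_center).
  destruct p as [[x y] z], i, j; simpl; repeat split; try apply Hc;
    first [exact Hu | exact Hv].
Qed.

(** Symmetry of second partial derivatives, by Schwarz's theorem in each pair of distinct
    coordinate directions. *)
Lemma partial_comm (f : R3 -> R) (i j : axis3) (p : R3) :
  class_C 2 f -> partial i (partial j f) p = partial j (partial i f) p.
Proof.
  intros [_ Hf].
  assert (H1 : forall i q, ex_partial i f q)
    by (intros i0; exact (proj1 (Hf i0))).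
  assert (H2 : forall i j q, ex_partial i (partial j f) q)
    by (intros i0 j0; exact (proj1 (proj2 (proj2 (Hf j0)) i0))).
  assert (H3 : forall i j q, continuous (partial i (partial j f)) q)
    by (intros i0 j0; exact (proj2 (proj2 (proj2 (Hf j0)) i0))).
  clear Hf.
  assert (key : forall i j, i <> j ->
    partial i (partial j f) p = partial j (partial i f) p).
  { intros i0 j0 Hij.
    set (F := fun u v => f (upd (upd p i0 u) j0 v)).
    pose proof (Schwarz F (coord p i0) (coord p j0)) as HS.
    assert (E1 : forall u v, Derive (fun t => Derive (fun s => F t s) v) u
                 = partial i0 (partial j0 f) (upd (upd p i0 u) j0 v)).
    { intros u v. destruct p as [[x y] z], i0, j0; try (case (Hij eq_refl));
        unfold F, partial; cbn [upd coord]; reflexivity. }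
    assert (E2 : forall u v, Derive (fun t => Derive (fun s => F s t) u) v
                 = partial j0 (partial i0 f) (upd (upd p i0 u) j0 v)).
    { intros u v. destruct p as [[x y] z], i0, j0; try (case (Hij eq_refl));
        unfold F, partial; cbn [upd coord]; reflexivity. }
    assert (Ep : upd (upd p i0 (coord p i0)) j0 (coord p j0) = p)
      by (rewrite upd_coord; apply upd_coord).
    rewrite E1, E2, Ep in HS.
    apply HS.
    - exists posreal_one. intros u v _ _.
      generalize (H1 i0 (upd (upd p i0 u) j0 v)), (H1 j0 (upd (upd p i0 u) j0 v)),
        (H2 i0 j0 (upd (upd p i0 u) j0 v)), (H2 j0 i0 (upd (upd p i0 u) j0 v)).
      unfold ex_partial, partial, F.
      destruct p as [[x y] z], i0, j0; try (case (Hij eq_refl)); cbn [upd coord]; intros A B C D;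
      (split; [exact A | split; [exact B | split; [exact C | exact D]]]).
    - apply continuity_2d_pt_ext with (2 := continuous_slice2 _ i0 j0 p _ _ (H3 i0 j0)).
      intros; symmetry; apply E1.
    - apply continuity_2d_pt_ext with (2 := continuous_slice2 _ i0 j0 p _ _ (H3 j0 i0)).
      intros; symmetry; apply E2. }
  assert (Hdec : i = j \/ i <> j) by (destruct i, j; (now left) || (right; discriminate)).
  destruct Hdec as [-> | Hij]; [reflexivity | apply key, Hij].
Qed.

(** * The Levi-Civita connection of SOL *)

Lemma exp_opp2 z : exp (2 * z) * exp (- 2 * z) = 1.
Proof. rewrite <- exp_plus, <- exp_0. f_equal; ring. Qed.

Definition sol_dmetric (p : R3) (k i j : axis3) : R :=
  match k, i, j with
  | Iz, Ix, Ix => - 2 * exp (- 2 * coord p Iz)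
  | Iz, Iy, Iy => 2 * exp (2 * coord p Iz)
  | _, _, _ => 0
  end.

Lemma is_derive_sol_metric (p : R3) (k i j : axis3) :
  is_derive (fun s => sol_metric (upd p k s) i j) (coord p k) (sol_dmetric p k i j).
Proof.
  destruct p as [[x y] z], k, i, j; simpl; auto_derive; auto; ring.
Qed.

Lemma partial_sol_metric (p : R3) (k i j : axis3) :
  partial k (fun q => sol_metric q i j) p = sol_dmetric p k i j.
Proof. apply is_derive_unique, is_derive_sol_metric. Qed.

Definition sol_christoffel (p : R3) (k i j : axis3) : R :=
  match k, i, j with
  | Ix, Ix, Iz | Ix, Iz, Ix => - 1
  | Iy, Iy, Iz | Iy, Iz, Iy => 1
  | Iz, Ix, Ix => exp (- 2 * coord p Iz)
  | Iz, Iy, Iy => - exp (2 * coord p Iz)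
  | _, _, _ => 0
  end.

(** Lowering the upper index of the Christoffel symbols gives back the symbols of the first
    kind, which are the ones that the Koszul formula produces. *)
Lemma sol_christoffel_lower (p : R3) (i j k : axis3) :
  / 2 * (sol_dmetric p i j k + sol_dmetric p j i k - sol_dmetric p k i j) =
  sum3 (fun m => sol_christoffel p m i j * sol_metric p m k).
Proof.
  destruct i, j, k; unfold sum3; simpl; lra.
Qed.

Lemma christoffel_sol (p : R3) (k i j : axis3) :
  christoffel sol_metric sol_cometric p k i j = sol_christoffel p k i j.
Proof.
  unfold christoffel, sum3. rewrite !partial_sol_metric.
  pose proof (exp_opp2 (coord p Iz)).
  destruct i, j, k; simpl; nra.
Qed.

(** * Integral curves of xi *)

Definition grayson_offset (a b c : R) (p : R3) : R :=
  a * coord p Ix - b * coord p Iy - c.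

(** The Hamiltonian of the (u, z)-system that [xi] induces; the Grayson cylinder is its
    level 1. *)
Definition grayson_energy (a b c : R) (p : R3) : R :=
  grayson_offset a b c p ^ 2 + a ^ 2 * exp (2 * coord p Iz) + b ^ 2 * exp (- 2 * coord p Iz).

Lemma grayson_iff_energy a b c p : grayson a b c p <-> grayson_energy a b c p = 1.
Proof. destruct p as [[x y] z]. reflexivity. Qed.

Lemma xi_coord a b c p :
  coord (xi a b c p) Ix = a * exp (2 * coord p Iz) /\
  coord (xi a b c p) Iy = b * exp (- 2 * coord p Iz) /\
  coord (xi a b c p) Iz = - grayson_offset a b c p.
Proof.
  destruct p as [[x y] z]. unfold grayson_offset. simpl. repeat split. ring.
Qed.

(** Along [xi] the offset u from the plane ax - by = c and the height z form a closed
    Hamiltonian system z' = - u, u' = a^2 exp (2 z) - b^2 exp (- 2 z). *)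
Lemma velocity_xi a b c gam t : velocity gam t (xi a b c (gam t)) ->
  is_derive (fun s => coord (gam s) Ix) t (a * exp (2 * coord (gam t) Iz)) /\
  is_derive (fun s => coord (gam s) Iy) t (b * exp (- 2 * coord (gam t) Iz)) /\
  is_derive (fun s => coord (gam s) Iz) t (- grayson_offset a b c (gam t)) /\
  is_derive (fun s => grayson_offset a b c (gam s)) t
    (a ^ 2 * exp (2 * coord (gam t) Iz) - b ^ 2 * exp (- 2 * coord (gam t) Iz)).
Proof.
  intros H. pose proof (H Ix) as Hx. pose proof (H Iy) as Hy. pose proof (H Iz) as Hz.
  destruct (xi_coord a b c (gam t)) as (E1 & E2 & E3). rewrite E1 in Hx. rewrite E2 in Hy.
  rewrite E3 in Hz. refine (conj Hx (conj Hy (conj Hz _))).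
  pose proof (is_derive_minus (V := R_NormedModule) _ _ t _ _
    (is_derive_minus (V := R_NormedModule) _ _ t _ _
      (is_derive_scal _ t a _ Hx) (is_derive_scal _ t b _ Hy)) (is_derive_const c t)) as D.
  replace (a ^ 2 * exp (2 * coord (gam t) Iz) - b ^ 2 * exp (- 2 * coord (gam t) Iz))
    with (a * (a * exp (2 * coord (gam t) Iz)) - b * (b * exp (- 2 * coord (gam t) Iz)) - 0)
    by ring.
  exact D.
Qed.

Lemma velocity_xi_exp a b c gam t : velocity gam t (xi a b c (gam t)) ->
  is_derive (fun s => a ^ 2 * exp (2 * coord (gam s) Iz)) t
    (- 2 * grayson_offset a b c (gam t) * (a ^ 2 * exp (2 * coord (gam t) Iz))) /\
  is_derive (fun s => b ^ 2 * exp (- 2 * coord (gam s) Iz)) t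
    (2 * grayson_offset a b c (gam t) * (b ^ 2 * exp (- 2 * coord (gam t) Iz))).
Proof.
  intros H. destruct (velocity_xi a b c gam t H) as (_ & _ & Hz & _).
  split.
  - pose proof (is_derive_scal _ t (a ^ 2) _ (is_derive_exp_scale _ _ _ 2 Hz)) as D.
    cbv beta in D. match type of D with is_derive _ _ ?r => replace (- 2 * _ * _) with r by ring end.
    exact D.
  - pose proof (is_derive_scal _ t (b ^ 2) _ (is_derive_exp_scale _ _ _ (-2) Hz)) as D.
    cbv beta in D. match type of D with is_derive _ _ ?r => replace (2 * _ * _) with r by ring end.
    exact D.
Qed.

Lemma energy_conserved a b c al be gam s t : integral_curve (xi a b c) al be gam ->
  in_interval al be s -> in_interval al be t ->
  grayson_energy a b c (gam s) = grayson_energy a b c (gam t).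
Proof.
  intros H. apply (is_derive_zero_interval al be (fun s => grayson_energy a b c (gam s))).
  clear s t. intros t Ht. specialize (H t Ht).
  destruct (velocity_xi a b c gam t H) as (_ & _ & _ & Hu).
  destruct (velocity_xi_exp a b c gam t H) as [Hp Hq].
  pose proof (is_derive_plus (V := R_NormedModule) _ _ t _ _
    (is_derive_plus (V := R_NormedModule) _ _ t _ _ (is_derive_pow _ 2 t _ Hu) Hp) Hq) as D.
  unfold grayson_energy.
  match type of D with is_derive _ _ ?r => replace 0 with r end; [exact D |].
  unfold plus; simpl. ring.
Qed.

(** Every integral curve of [xi], on the cylinder or not, is a geodesic: on SOL the momenta
    exp (- 2 z) x' and exp (2 z) y' of a geodesic are constant, here a and b, and the
    remaining equation for z'' is the derivative of z' = - u. *)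
Lemma geodesic_xi a b c al be gam :
  integral_curve (xi a b c) al be gam -> sol_geodesic al be gam.
Proof.
  intros H t Ht k.
  assert (Dloc : forall k, locally t (fun s =>
    coord (xi a b c (gam s)) k = Derive (fun r => coord (gam r) k) s)).
  { intros k0. apply (filter_imp (fun s => in_interval al be s)).
    - intros s Hs. symmetry. apply is_derive_unique, (H s Hs k0).
    - now apply locally_in_interval. }
  assert (D1 : forall k, Derive (fun r => coord (gam r) k) t = coord (xi a b c (gam t)) k)
    by (intros k0; apply is_derive_unique, (H t Ht k0)).
  destruct (xi_coord a b c (gam t)) as (E1 & E2 & E3).
  destruct (velocity_xi a b c gam t (H t Ht)) as (Hx & Hy & Hz & Hu).
  assert (D2 : is_derive (fun s => coord (xi a b c (gam s)) k) t
    (- sum3 (fun i => sum3 (fun j => sol_christoffel (gam t) k i j *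
        coord (xi a b c (gam t)) i * coord (xi a b c (gam t)) j)))).
  { unfold sum3. rewrite E1, E2, E3.
    pose proof (exp_opp2 (coord (gam t) Iz)) as Hinv.
    destruct k; simpl sol_christoffel.
    - apply (is_derive_ext (fun s => a * exp (2 * coord (gam s) Iz))).
      { intros s. symmetry. apply xi_coord. }
      pose proof (is_derive_scal _ t a _ (is_derive_exp_scale _ _ _ 2 Hz)) as D.
      match type of D with is_derive _ _ ?r => replace (- _) with r by ring end. exact D.
    - apply (is_derive_ext (fun s => b * exp (- 2 * coord (gam s) Iz))).
      { intros s. symmetry. apply xi_coord. }
      pose proof (is_derive_scal _ t b _ (is_derive_exp_scale _ _ _ (-2) Hz)) as D.
      match type of D with is_derive _ _ ?r => replace (- _) with r by ring end. exact D.
    - apply (is_derive_ext (fun s => - grayson_offset a b c (gam s))).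
      { intros s. symmetry. apply xi_coord. }
      pose proof (is_derive_opp (V := R_NormedModule) _ t _ Hu) as D.
      match type of D with is_derive _ _ ?r => replace (- _) with r end; [exact D |].
      unfold opp; simpl.
      transitivity (b ^ 2 * exp (- 2 * coord (gam t) Iz) * 1
        - a ^ 2 * exp (2 * coord (gam t) Iz) * 1); [ring |].
      rewrite <- Hinv. ring. }
  split; [exists (coord (xi a b c (gam t)) k); apply (H t Ht k) |].
  split.
  - apply (ex_derive_ext_loc _ _ t (Dloc k)). eexists; exact D2.
  - assert (D3 : Derive (Derive (fun r => coord (gam r) k)) t =
      - sum3 (fun i => sum3 (fun j => sol_christoffel (gam t) k i j *
        coord (xi a b c (gam t)) i * coord (xi a b c (gam t)) j))).
    { transitivity (Derive (fun s => coord (xi a b c (gam s)) k) t).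
      - symmetry. apply Derive_ext_loc, Dloc.
      - apply is_derive_unique, D2. }
    rewrite D3. unfold sum3. rewrite !christoffel_sol, !D1. ring.
Qed.

(** * Uniqueness of integral curves of xi *)

(** Gronwall's argument in both time directions: exp (- K t) W t is nonincreasing and
    exp (K t) W t is nondecreasing. *)
Lemma gronwall_zero (W dW : R -> R) (K : R) :
  (forall t, is_derive W t (dW t)) -> (forall t, Rabs (dW t) <= K * W t) ->
  (forall t, 0 <= W t) -> W 0 = 0 -> forall t, W t = 0.
Proof.
  intros HW HK Hpos H0 t.
  assert (HD : forall k s, is_derive (fun s => exp (k * s) * W s) s
    (exp (k * s) * (k * W s + dW s))).
  { intros k s. auto_derive; [exists (dW s); apply HW |].
    rewrite (is_derive_unique W s (dW s) (HW s) : Derive (fun x => W x) s = dW s). ring. }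
  apply Rle_antisym; [| apply Hpos].
  destruct (Rle_lt_dec 0 t) as [Ht | Ht].
  - pose proof (nonneg_derive_le (fun s => - (exp (- K * s) * W s)) _
      (fun s => is_derive_opp (V := R_NormedModule) _ s _ (HD (- K) s))) as Hm.
    pose proof (exp_pos (- K * t)).
    assert (- (exp (- K * 0) * W 0) <= - (exp (- K * t) * W t)).
    { apply Hm; [| exact Ht]. intros s. unfold opp; simpl.
      pose proof (exp_pos (- K * s)). pose proof (HK s). pose proof (Rle_abs (dW s)). nra. }
    rewrite H0 in *. nra.
  - pose proof (nonneg_derive_le (fun s => exp (K * s) * W s) _ (HD K)) as Hm.
    pose proof (exp_pos (K * t)).
    assert (exp (K * t) * W t <= exp (K * 0) * W 0).
    { apply Hm; [| lra]. intros s.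
      pose proof (exp_pos (K * s)). pose proof (HK s). pose proof (Rabs_maj2 (dW s)). nra. }
    rewrite H0 in *. nra.
Qed.

Lemma Rabs_bilinear_le (M s x y : R) : Rabs s <= M -> Rabs (s * (x * y)) <= M * (x ^ 2 + y ^ 2) / 2.
Proof.
  intros Hs. rewrite !Rabs_mult.
  assert (Rabs x * Rabs y <= (x ^ 2 + y ^ 2) / 2).
  { rewrite <- (pow2_abs x), <- (pow2_abs y).
    pose proof (pow2_ge_0 (Rabs x - Rabs y)). nra. }
  pose proof (Rabs_pos s). pose proof (Rabs_pos x). pose proof (Rabs_pos y).
  assert (0 <= Rabs x * Rabs y) by nra.
  apply Rle_trans with (M * (Rabs x * Rabs y)); nra.
Qed.

Lemma exp_scale_inj k z z' r : k <> 0 -> r <> 0 ->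
  r ^ 2 * exp (k * z) = r ^ 2 * exp (k * z') -> z = z'.
Proof.
  intros Hk Hr E. apply Rmult_eq_reg_l in E; [| nra].
  apply exp_inv in E. apply (Rmult_eq_reg_l k); assumption.
Qed.

(** The field is not globally Lipschitz, but in the variables u, p = a^2 exp (2 z) and
    q = b^2 exp (- 2 z) the equations are quadratic, and conservation of u^2 + p + q with
    p, q positive bounds all three. *)
Lemma xi_integral_curve_unique a b c gam1 gam2 : a <> 0 ->
  integral_curve (xi a b c) m_infty p_infty gam1 ->
  integral_curve (xi a b c) m_infty p_infty gam2 ->
  gam1 0 = gam2 0 -> forall t, gam1 t = gam2 t.
Proof.
  intros Ha H1 H2 H0.
  set (u (gam : R -> R3) t := grayson_offset a b c (gam t)).
  set (p (gam : R -> R3) t := a ^ 2 * exp (2 * coord (gam t) Iz)).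
  set (q (gam : R -> R3) t := b ^ 2 * exp (- 2 * coord (gam t) Iz)).
  assert (HD : forall gam, integral_curve (xi a b c) m_infty p_infty gam -> forall t,
    is_derive (u gam) t (p gam t - q gam t) /\
    is_derive (p gam) t (- 2 * u gam t * p gam t) /\
    is_derive (q gam) t (2 * u gam t * q gam t)).
  { intros gam H t. specialize (H t (in_interval_line t)).
    split; [apply (velocity_xi a b c gam t H) | apply (velocity_xi_exp a b c gam t H)]. }
  set (M := 1 + grayson_energy a b c (gam1 0)).
  assert (HB : forall gam, integral_curve (xi a b c) m_infty p_infty gam ->
    gam 0 = gam1 0 -> forall t, 1 <= M /\ Rabs (u gam t) <= M /\ Rabs (p gam t) <= M /\ Rabs (q gam t) <= M).
  { intros gam H E t.
    pose proof (energy_conserved a b c _ _ gam t 0 H (in_interval_line t) (in_interval_line 0)) as Hc.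
    rewrite E in Hc. unfold M. rewrite <- Hc. unfold grayson_energy. fold (u gam t) (p gam t) (q gam t).
    assert (0 <= p gam t) by (apply Rmult_le_pos; [apply pow2_ge_0 | apply Rlt_le, exp_pos]).
    assert (0 <= q gam t) by (apply Rmult_le_pos; [apply pow2_ge_0 | apply Rlt_le, exp_pos]).
    pose proof (pow2_ge_0 (u gam t)).
    split; [lra |]. split; [| split]; apply Rabs_le; split; nra. }
  assert (HB1 := HB gam1 H1 eq_refl). assert (HB2 := HB gam2 H2 (eq_sym H0)).
  assert (HD1 := HD gam1 H1). assert (HD2 := HD gam2 H2). clear HB HD.
  set (W t := (p gam1 t - p gam2 t) ^ 2 + (q gam1 t - q gam2 t) ^ 2 + (u gam1 t - u gam2 t) ^ 2).
  assert (HW : forall t, W t = 0).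
  { apply (gronwall_zero W (fun t =>
      2 * (p gam1 t - p gam2 t) * (- 2 * u gam1 t * p gam1 t - - 2 * u gam2 t * p gam2 t)
      + 2 * (q gam1 t - q gam2 t) * (2 * u gam1 t * q gam1 t - 2 * u gam2 t * q gam2 t)
      + 2 * (u gam1 t - u gam2 t) * ((p gam1 t - q gam1 t) - (p gam2 t - q gam2 t))) (12 * M)).
    - intros t. destruct (HD1 t) as (A1 & A2 & A3). destruct (HD2 t) as (B1 & B2 & B3).
      pose proof (is_derive_plus (V := R_NormedModule) _ _ t _ _
        (is_derive_plus (V := R_NormedModule) _ _ t _ _
          (is_derive_pow _ 2 t _ (is_derive_minus (V := R_NormedModule) _ _ t _ _ A2 B2))
          (is_derive_pow _ 2 t _ (is_derive_minus (V := R_NormedModule) _ _ t _ _ A3 B3)))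
        (is_derive_pow _ 2 t _ (is_derive_minus (V := R_NormedModule) _ _ t _ _ A1 B1))) as D.
      unfold W.
      match type of D with is_derive _ _ ?r => match goal with |- is_derive _ _ ?s =>
        replace s with r end end; [exact D |].
      unfold plus, minus, opp; simpl. unfold plus, minus, opp; simpl. ring.
    - intros t. destruct (HB1 t) as (HM & B1 & _). destruct (HB2 t) as (_ & _ & B2 & B3).
      unfold W. set (P := p gam1 t - p gam2 t). set (Q := q gam1 t - q gam2 t).
      set (U := u gam1 t - u gam2 t).
      replace (2 * P * _ + _ + _) with
        (- 4 * (u gam1 t * (P * P)) - 4 * (p gam2 t * (P * U)) + 4 * (u gam1 t * (Q * Q))
         + 4 * (q gam2 t * (Q * U)) + 2 * (1 * (P * U)) - 2 * (1 * (Q * U)))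
        by (unfold P, Q, U; ring).
      pose proof (Rabs_bilinear_le M _ P P B1) as C1.
      pose proof (Rabs_bilinear_le M _ P U B2) as C2.
      pose proof (Rabs_bilinear_le M _ Q Q B1) as C3.
      pose proof (Rabs_bilinear_le M _ Q U B3) as C4.
      assert (B4 : Rabs 1 <= M) by (rewrite Rabs_R1; exact HM).
      pose proof (Rabs_bilinear_le M _ P U B4) as C5.
      pose proof (Rabs_bilinear_le M _ Q U B4) as C6.
      apply Rabs_le_between in C1, C2, C3, C4, C5, C6.
      assert (0 <= M * P ^ 2) by (apply Rmult_le_pos; [lra | apply pow2_ge_0]).
      assert (0 <= M * Q ^ 2) by (apply Rmult_le_pos; [lra | apply pow2_ge_0]).
      assert (0 <= M * U ^ 2) by (apply Rmult_le_pos; [lra | apply pow2_ge_0]).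
      apply Rabs_le. split; lra.
    - intros t. unfold W.
      repeat apply Rplus_le_le_0_compat; apply pow2_ge_0.
    - unfold W, p, q, u. rewrite H0. ring. }
  assert (Hz : forall t, coord (gam1 t) Iz = coord (gam2 t) Iz).
  { intros t. apply (exp_scale_inj 2 _ _ a); [lra | exact Ha |].
    pose proof (HW t) as E. unfold W in E. fold (p gam1 t) (p gam2 t).
    pose proof (pow2_ge_0 (q gam1 t - q gam2 t)). pose proof (pow2_ge_0 (u gam1 t - u gam2 t)).
    pose proof (pow2_ge_0 (p gam1 t - p gam2 t)).
    assert (E1 : (p gam1 t - p gam2 t) ^ 2 = 0) by lra.
    assert (p gam1 t - p gam2 t = 0) by (apply Rsqr_0_uniq; unfold Rsqr; lra). lra. }
  assert (same : forall i, i <> Iz -> forall t, coord (gam1 t) i = coord (gam2 t) i).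
  { intros i Hi t.
    assert (E : coord (gam1 t) i - coord (gam2 t) i = coord (gam1 0) i - coord (gam2 0) i).
    { apply (is_derive_zero_const (fun s => coord (gam1 s) i - coord (gam2 s) i)).
      intros s.
      destruct (velocity_xi a b c gam1 s (H1 s (in_interval_line s))) as (X1 & Y1 & _).
      destruct (velocity_xi a b c gam2 s (H2 s (in_interval_line s))) as (X2 & Y2 & _).
      rewrite <- Hz in X2, Y2.
      destruct i; [| | now elim Hi].
      - pose proof (is_derive_minus (V := R_NormedModule) _ _ s _ _ X1 X2) as D.
        rewrite minus_eq_zero in D. exact D.
      - pose proof (is_derive_minus (V := R_NormedModule) _ _ s _ _ Y1 Y2) as D.
        rewrite minus_eq_zero in D. exact D. }
    rewrite H0 in E. lra. }
  intros t. apply coord_ext. intros []; [apply same; discriminate | apply same; discriminate | apply Hz].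
Qed.

(** * Completeness of xi *)

Lemma is_derive_RInt_continuous (f : R -> R) (x0 : R) :
  (forall x, continuous f x) -> forall x, is_derive (fun x => RInt f x0 x) x (f x).
Proof.
  intros Hf x. apply (is_derive_RInt f (fun x => RInt f x0 x) x0 x); [| apply Hf].
  apply filter_forall. intros y. apply (RInt_correct (V := R_CompleteNormedModule)),
    (ex_RInt_continuous (V := R_CompleteNormedModule)).
  intros z _. apply Hf.
Qed.

Lemma continuous_ivt (f : R -> R) (x y t : R) : (forall x, continuous f x) ->
  x <= y -> f x <= t <= f y -> exists r, f r = t.
Proof.
  intros Hf Hxy Ht.
  destruct (IVT_gen f x y t) as (r & _ & Hr).
  - intros r. apply continuity_pt_filterlim, Hf.
  - rewrite Rmin_left, Rmax_right; lra.
  - exists r. exact Hr.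
Qed.

(** Separation of variables: the primitive F of 1 / S is an increasing bijection of the
    line because 1 / S lies between two positive constants, and its inverse is the solution. *)
Lemma autonomous_ode (S : R -> R) (lo hi f0 : R) :
  0 < lo -> (forall x, lo <= S x <= hi) -> (forall x, continuous S x) ->
  exists f : R -> R, f 0 = f0 /\ forall t, is_derive f t (S (f t)).
Proof.
  intros Hlo HS Hc.
  assert (Hpos : forall x, 0 < S x) by (intros x; pose proof (HS x); lra).
  assert (Hhi : 0 < hi) by (pose proof (HS 0); lra).
  set (F := fun x => RInt (fun s => / S s) f0 x : R).
  assert (DF : forall x, is_derive F x (/ S x)).
  { apply is_derive_RInt_continuous. intros x. apply continuous_Rinv_comp; [apply Hc |].
    pose proof (Hpos x). lra. }
  assert (F0 : F f0 = 0)
    by exact (RInt_point (V := R_CompleteNormedModule) f0 (fun s => / S s)).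
  assert (Hinv : forall x, / hi <= / S x) by (intros x; apply Rinv_le_contravar; [apply Hpos | apply HS]).
  assert (grow : forall x y, x <= y -> (y - x) * / hi <= F y - F x).
  { intros x y Hxy.
    pose proof (nonneg_derive_le (fun s => F s - s * / hi) (fun s => / S s - 1 * / hi)) as Hm.
    assert (F x - x * / hi <= F y - y * / hi).
    { apply Hm; [| | exact Hxy].
      - intros s. apply (is_derive_minus (V := R_NormedModule)); [apply DF |].
        apply (is_derive_scal_l (V := R_NormedModule)). apply @is_derive_id.
      - intros s. pose proof (Hinv s). lra. }
    lra. }
  assert (Hhi' : 0 < / hi) by now apply Rinv_0_lt_compat.
  assert (surj : forall t, exists x, F x = t).
  { intros t.
    assert (Hlen : forall r, r * hi * / hi = r) by (intros r; field; lra).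
    destruct (Rle_lt_dec 0 t) as [Ht | Ht].
    - apply (continuous_ivt F f0 (f0 + t * hi)).
      + intros x. apply (ex_derive_continuous F). eexists; apply DF.
      + nra.
      + pose proof (grow f0 (f0 + t * hi) ltac:(nra)) as G.
        replace (f0 + t * hi - f0) with (t * hi) in G by ring. rewrite Hlen in G. lra.
    - apply (continuous_ivt F (f0 + t * hi) f0).
      + intros x. apply (ex_derive_continuous F). eexists; apply DF.
      + nra.
      + pose proof (grow (f0 + t * hi) f0 ltac:(nra)) as G.
        replace (f0 - (f0 + t * hi)) with ((- t) * hi) in G by ring. rewrite Hlen in G. lra. }
  set (f t := proj1_sig (constructive_indefinite_description _ (surj t))).
  assert (Hf : forall t, F (f t) = t)
    by (intros t; exact (proj2_sig (constructive_indefinite_description _ (surj t)))).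
  assert (inj : forall x y, F x = F y -> x = y).
  { intros x y E. destruct (Rle_lt_dec x y) as [H | H].
    - pose proof (grow x y H). nra.
    - pose proof (grow y x (Rlt_le _ _ H)). nra. }
  (* By the mean value theorem for F, a difference quotient of f is a value of S at an
     intermediate point, and f is Lipschitz, so that this point tends to f t. *)
  assert (MVT : forall t h, exists x,
    Rabs (x - f t) <= hi * Rabs h /\ f (t + h) - f t = S x * h).
  { intros t h.
    destruct (MVT_gen F (f t) (f (t + h)) (fun x => / S x)) as (x & Hx & E).
    - intros x _. apply DF.
    - intros x _. apply continuity_pt_filterlim, (ex_derive_continuous F). eexists; apply DF.
    - exists x. rewrite !Hf in E. pose proof (Hpos x) as Hp. pose proof (HS x).
      assert (E' : f (t + h) - f t = S x * h).
      { apply (Rmult_eq_reg_l (/ S x)); [| apply Rinv_neq_0_compat; lra].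
        rewrite <- E. field. lra. }
      split; [| exact E'].
      apply Rle_trans with (Rabs (f (t + h) - f t)).
      + revert Hx. unfold Rmin, Rmax.
        destruct (Rle_dec (f t) (f (t + h))); intros Hx; unfold Rabs;
          repeat destruct Rcase_abs; lra.
      + rewrite E', Rabs_mult, (Rabs_pos_eq (S x)) by lra.
        pose proof (Rabs_pos h). nra. }
  exists f. split; [apply inj; rewrite Hf, F0; reflexivity |].
  intros t. apply is_derive_Reals. intros eps Heps.
  assert (Hct : exists d, 0 < d /\ forall x, Rabs (x - f t) < d -> Rabs (S x - S (f t)) < eps).
  { destruct (Hc (f t) (fun y => Rabs (y - S (f t)) < eps)) as [d Hd].
    - exists (mkposreal eps Heps). intros y Hy. exact Hy.
    - exists d. split; [apply cond_pos |]. intros x Hx. apply Hd. exact Hx. }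
  destruct Hct as (d & Hd & Hd').
  assert (Hdh : 0 < d / hi) by (apply Rdiv_lt_0_compat; assumption).
  exists (mkposreal (d / hi) Hdh). intros h Hh Hlt. simpl in Hlt.
  destruct (MVT t h) as (x & Hx & E). rewrite E.
  replace (S x * h / h - S (f t)) with (S x - S (f t)) by (field; exact Hh).
  apply Hd'. apply Rle_lt_trans with (1 := Hx).
  apply (Rmult_lt_reg_r (/ hi)); [exact Hhi' |].
  replace (hi * Rabs h * / hi) with (Rabs h) by (field; lra). exact Hlt.
Qed.

Lemma polar_coordinates (x y : R) : exists m f, x = m * cos f /\ y = m * sin f.
Proof.
  set (m := sqrt (x ^ 2 + y ^ 2)).
  assert (Hm2 : m * m = x ^ 2 + y ^ 2) by (apply sqrt_sqrt; nra).
  assert (Hm0 : 0 <= m) by apply sqrt_pos.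
  destruct (Req_dec m 0) as [E | E].
  - exists 0, 0. rewrite E in Hm2. split; nra.
  - assert (Hx : -1 <= x / m <= 1).
    { split; [apply (Rmult_le_reg_r m); [lra |] | apply (Rmult_le_reg_r m); [lra |]];
        unfold Rdiv; rewrite Rmult_assoc, Rinv_l by exact E; nra. }
    assert (Hs : m * sin (acos (x / m)) = Rabs y).
    { rewrite sin_acos by exact Hx.
      rewrite <- (sqrt_Rsqr (Rabs y)) by apply Rabs_pos.
      rewrite <- (sqrt_Rsqr m) at 1 by exact Hm0.
      rewrite <- sqrt_mult_alt by apply Rle_0_sqr. f_equal.
      rewrite <- Rsqr_abs. unfold Rsqr.
      transitivity (m * m - x * x); [field; exact E |]. rewrite Hm2. ring. }
    assert (Hcx : m * cos (acos (x / m)) = x) by (rewrite cos_acos by exact Hx; field; exact E).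
    destruct (Rle_lt_dec 0 y) as [Hy | Hy].
    + exists m, (acos (x / m)). rewrite Hs, Hcx, Rabs_pos_eq by exact Hy. auto.
    + exists m, (- acos (x / m)).
      rewrite cos_neg, sin_neg, Hcx, Ropp_mult_distr_r_reverse, Hs, Rabs_left by exact Hy.
      split; ring.
Qed.

(** Completeness of [xi]. Put u = m sin f and |a| exp z - |b| exp (- z) = m cos f, where m is
    constant by conservation of energy. Then |a| exp z + |b| exp (- z) is
    S f = sqrt (m^2 cos^2 f + 4 |ab|), and the (u, z)-system becomes the scalar equation
    f' = S f. This avoids elliptic functions and their turning points. Then x and y are
    primitives. *)
Lemma xi_integral_curve_exists a b c p : a <> 0 -> b <> 0 ->
  exists gam, gam 0 = p /\ integral_curve (xi a b c) m_infty p_infty gam.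
Proof.
  intros Ha Hb. destruct p as [[x0 y0] z0].
  destruct (polar_coordinates (Rabs a * exp z0 - Rabs b * exp (- z0)) (a * x0 - b * y0 - c))
    as (m & f0 & Ecos & Esin).
  assert (Hr : 0 < Rabs a * Rabs b) by (apply Rmult_lt_0_compat; now apply Rabs_pos_lt).
  set (r := Rabs a * Rabs b) in *.
  (* S is |a| exp z + |b| exp (- z) as a function of the phase f; it stays between two
     positive constants, so that the phase equation f' = S f is solvable for all times. *)
  set (S f := sqrt ((m * cos f) ^ 2 + 4 * r)).
  assert (Hrad : forall f, 0 < (m * cos f) ^ 2 + 4 * r)
    by (intros f; pose proof (pow2_ge_0 (m * cos f)); lra).
  assert (HS2 : forall f, S f * S f = (m * cos f) ^ 2 + 4 * r)
    by (intros f; apply sqrt_sqrt, Rlt_le, Hrad).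
  assert (HSpos : forall f, 0 < S f) by (intros f; apply sqrt_lt_R0, Hrad).
  assert (DS : forall f, is_derive S f (- m ^ 2 * cos f * sin f / S f)).
  { intros f. unfold S. auto_derive; [apply Hrad |].
    change (m * (1 * - sin f) * ((1 + 1) * (m * cos f * 1)) * / (2 * S f)
      = - m ^ 2 * cos f * sin f / S f).
    pose proof (HSpos f). field. lra. }
  destruct (autonomous_ode S (sqrt (4 * r)) (sqrt (m ^ 2 + 4 * r)) f0) as (f & Hf0 & Df).
  { apply sqrt_lt_R0. lra. }
  { intros g. split; apply sqrt_le_1_alt; rewrite Rpow_mult_distr.
    - pose proof (pow2_ge_0 m). pose proof (pow2_ge_0 (cos g)). nra.
    - pose proof (sin2_cos2 g) as Hsc. unfold Rsqr in Hsc.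
      pose proof (pow2_ge_0 m). pose proof (pow2_ge_0 (sin g)). nra. }
  { intros g. apply (ex_derive_continuous S). eexists; apply DS. }
  set (w t := m * cos (f t) + S (f t)).
  assert (Hw : forall t, 0 < w t).
  { intros t. unfold w. pose proof (HS2 (f t)). pose proof (HSpos (f t)). nra. }
  assert (Haa : 0 < Rabs a) by now apply Rabs_pos_lt.
  set (z t := ln (w t / (2 * Rabs a))).
  assert (Hwa : forall t, 0 < w t / (2 * Rabs a))
    by (intros t; apply Rdiv_lt_0_compat; [apply Hw | lra]).
  assert (Ez : forall t, Rabs a * exp (z t) = w t / 2).
  { intros t. unfold z. rewrite exp_ln by apply Hwa. field. lra. }
  assert (Ez' : forall t, Rabs b * exp (- z t) = (S (f t) - m * cos (f t)) / 2).
  { intros t. apply (Rmult_eq_reg_l (Rabs a * exp (z t))).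
    - transitivity (r * (exp (z t) * exp (- z t))); [unfold r; ring |].
      rewrite <- exp_plus, Rplus_opp_r, exp_0, Ez. unfold w. pose proof (HS2 (f t)). nra.
    - rewrite Ez. pose proof (Hw t). lra. }
  assert (sq : forall d v, d ^ 2 * exp (2 * v) = (Rabs d * exp v) ^ 2).
  { intros d v. rewrite Rpow_mult_distr, pow2_abs. f_equal. simpl. rewrite Rmult_1_r, <- exp_plus.
    f_equal; ring. }
  assert (Dw : forall t, is_derive w t (- m * sin (f t) * w t)).
  { intros t.
    assert (D : is_derive w t (m * (- sin (f t) * S (f t))
      + S (f t) * (- m ^ 2 * cos (f t) * sin (f t) / S (f t)))).
    { apply (is_derive_plus (V := R_NormedModule)).
      - apply is_derive_scal. auto_derive; [exists (S (f t)); apply Df |].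
        rewrite (is_derive_unique f t _ (Df t) : Derive (fun x => f x) t = _). ring.
      - apply (is_derive_comp S f); [apply DS | apply Df]. }
    replace (- m * sin (f t) * w t) with (m * (- sin (f t) * S (f t))
      + S (f t) * (- m ^ 2 * cos (f t) * sin (f t) / S (f t))); [exact D |].
    unfold w. pose proof (HSpos (f t)). field. lra. }
  assert (Dz : forall t, is_derive z t (- m * sin (f t))).
  { intros t. unfold z. auto_derive; [split; [exists (- m * sin (f t) * w t); apply Dw |] |].
    - pose proof (Hwa t) as Hp. unfold Rdiv in Hp. split; [exact Hp | exact I].
    - rewrite (is_derive_unique w t _ (Dw t) : Derive (fun x => w x) t = _).
      pose proof (Hw t). field. lra. }
  assert (cz : forall k d t, continuous (fun t => d * exp (k * z t)) t).
  { intros k d t. apply (ex_derive_continuous (fun t => d * exp (k * z t))).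
    auto_derive. eexists; apply Dz. }
  set (x t := x0 + RInt (fun t => a * exp (2 * z t)) 0 t).
  set (y t := y0 + RInt (fun t => b * exp (- 2 * z t)) 0 t).
  assert (Dx : forall t, is_derive x t (a * exp (2 * z t))).
  { intros t. rewrite <- (Rplus_0_l (a * _)).
    apply (is_derive_plus (V := R_NormedModule)); [apply @is_derive_const |].
    apply (is_derive_RInt_continuous (fun t => a * exp (2 * z t))). apply cz. }
  assert (Dy : forall t, is_derive y t (b * exp (- 2 * z t))).
  { intros t. rewrite <- (Rplus_0_l (b * _)).
    apply (is_derive_plus (V := R_NormedModule)); [apply @is_derive_const |].
    apply (is_derive_RInt_continuous (fun t => b * exp (- 2 * z t))). apply cz. }
  assert (Hx0 : x 0 = x0) by
    (unfold x; rewrite (RInt_point (V := R_CompleteNormedModule)); apply Rplus_0_r).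
  assert (Hy0 : y 0 = y0) by
    (unfold y; rewrite (RInt_point (V := R_CompleteNormedModule)); apply Rplus_0_r).
  assert (Hu : forall t, a * x t - b * y t - c = m * sin (f t)).
  { intros t.
    cut (a * x t - b * y t - c - m * sin (f t) = a * x 0 - b * y 0 - c - m * sin (f 0)).
    { rewrite Hx0, Hy0, Hf0, <- Esin. lra. }
    apply (is_derive_zero_const (fun t => a * x t - b * y t - c - m * sin (f t))).
    clear t. intros t.
    assert (Dsin : is_derive (fun t => m * sin (f t)) t (m * (cos (f t) * S (f t)))).
    { apply is_derive_scal. auto_derive; [exists (S (f t)); apply Df |].
      rewrite (is_derive_unique f t _ (Df t) : Derive (fun x => f x) t = _). ring. }
    pose proof (is_derive_minus (V := R_NormedModule) _ _ t _ _
      (is_derive_minus (V := R_NormedModule) _ _ t _ _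
        (is_derive_minus (V := R_NormedModule) _ _ t _ _
          (is_derive_scal _ t a _ (Dx t)) (is_derive_scal _ t b _ (Dy t)))
        (is_derive_const c t)) Dsin) as D.
    match type of D with is_derive _ _ ?v => assert (E : v = 0) end.
    { change (a * (a * exp (2 * z t)) - b * (b * exp (- 2 * z t)) - 0
        - m * (cos (f t) * S (f t)) = 0).
      pose proof (sq a (z t)) as Q1. pose proof (sq b (- z t)) as Q2.
      rewrite Ez in Q1. rewrite Ez' in Q2. replace (2 * - z t) with (- 2 * z t) in Q2 by ring.
      unfold w in Q1. lra. }
    rewrite E in D. exact D. }
  exists (fun t => (x t, y t, z t)). split.
  - rewrite Hx0, Hy0. f_equal. unfold z, w. rewrite Hf0, <- Ecos.
    assert (ES : S f0 = Rabs a * exp z0 + Rabs b * exp (- z0)).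
    { unfold S. rewrite <- Ecos. rewrite <- (sqrt_pow2 (Rabs a * exp z0 + Rabs b * exp (- z0))).
      - f_equal. replace (4 * r) with (4 * r * (exp z0 * exp (- z0))).
        + unfold r. ring.
        + rewrite <- exp_plus, Rplus_opp_r, exp_0. ring.
      - pose proof (exp_pos z0). pose proof (exp_pos (- z0)). pose proof (Rabs_pos b). nra. }
    rewrite ES. transitivity (ln (exp z0)); [f_equal; field; lra | apply ln_exp].
  - intros t _ [].
    + apply Dx.
    + apply Dy.
    + simpl. replace (c - a * x t + b * y t) with (- m * sin (f t)).
      * apply Dz.
      * pose proof (Hu t). lra.
Qed.

(** * The translations along the axis and the two flows *)

(** The flow of [eta]: translations along the axis. *)
Definition shift (a b t : R) (p : R3) : R3 := vadd p (vscale t (axis_direction a b)).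

Lemma coord_shift a b t p i : coord (shift a b t p) i = coord p i + t * coord (axis_direction a b) i.
Proof. destruct p as [[x y] z], i; reflexivity. Qed.

Lemma coord_eta a b p i : coord (eta a b p) i = coord (axis_direction a b) i.
Proof. reflexivity. Qed.

Lemma offset_shift a b c t p : grayson_offset a b c (shift a b t p) = grayson_offset a b c p.
Proof. unfold grayson_offset. rewrite !coord_shift. simpl. ring. Qed.

Lemma shift_z a b t p : coord (shift a b t p) Iz = coord p Iz.
Proof. rewrite coord_shift. simpl. ring. Qed.

Lemma energy_shift a b c t p : grayson_energy a b c (shift a b t p) = grayson_energy a b c p.
Proof. unfold grayson_energy. rewrite offset_shift, shift_z. reflexivity. Qed.

Lemma shift_grayson a b c t p : grayson a b c p -> grayson a b c (shift a b t p).
Proof. rewrite !grayson_iff_energy, energy_shift. auto. Qed.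

Lemma xi_shift a b c t p : xi a b c (shift a b t p) = xi a b c p.
Proof.
  apply coord_ext. destruct (xi_coord a b c p) as (E1 & E2 & E3).
  destruct (xi_coord a b c (shift a b t p)) as (F1 & F2 & F3).
  rewrite shift_z in F1, F2. rewrite offset_shift in F3. intros []; congruence.
Qed.

Lemma integral_curve_eta_shift a b al be gam s t :
  integral_curve (eta a b) al be gam -> in_interval al be s -> in_interval al be t ->
  gam t = shift a b (t - s) (gam s).
Proof.
  intros H Hs Ht. apply coord_ext. intros i. rewrite coord_shift.
  cut (coord (gam t) i - coord (axis_direction a b) i * t
       = coord (gam s) i - coord (axis_direction a b) i * s); [lra |].
  apply (is_derive_zero_interval al be
    (fun r => coord (gam r) i - coord (axis_direction a b) i * r)); [| exact Ht | exact Hs].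
  intros r Hr. pose proof (H r Hr i) as D. rewrite coord_eta in D.
  set (v := coord (axis_direction a b) i) in *.
  assert (D' : is_derive (fun r => coord (gam r) i - v * r) r (v - v * 1)).
  { apply (is_derive_minus (V := R_NormedModule)); [exact D |].
    apply is_derive_scal. apply @is_derive_id. }
  replace (v - v * 1) with 0 in D' by ring. exact D'.
Qed.

Lemma integral_curve_shift a b al be p : integral_curve (eta a b) al be (fun t => shift a b t p).
Proof.
  intros t _ i. rewrite coord_eta.
  apply (is_derive_ext (fun s => coord p i + s * coord (axis_direction a b) i)).
  { intros s. symmetry. apply coord_shift. }
  generalize (coord p i), (coord (axis_direction a b) i). intros u v.
  auto_derive; [exact I | ring].
Qed.

Lemma tangent_of_integral_curve S V gam p :
  gam 0 = p -> integral_curve V m_infty p_infty gam -> (forall t, S (gam t)) ->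
  (forall i t, continuous (fun s => coord (V (gam s)) i) t) -> tangent_to S p (V p).
Proof.
  intros H0 H HS Hc. exists gam, 1. split; [lra |]. split; [exact H0 |].
  split; [rewrite <- H0; apply H, in_interval_line |].
  intros t _. split; [apply HS |]. intros i.
  split; [eexists; apply (H t (in_interval_line t)) |].
  apply (continuous_ext (fun s => coord (V (gam s)) i)); [| apply Hc].
  intros s. symmetry. apply is_derive_unique, (H s (in_interval_line s)).
Qed.

Lemma continuous_xi_along a b c gam :
  integral_curve (xi a b c) m_infty p_infty gam ->
  forall i t, continuous (fun s => coord (xi a b c (gam s)) i) t.
Proof.
  intros H i t.
  apply (continuous_ext (Derive (fun s => coord (gam s) i))).
  { intros s. apply is_derive_unique, (H s (in_interval_line s)). }
  apply (ex_derive_continuous (Derive (fun s => coord (gam s) i))).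
  apply (geodesic_xi a b c _ _ gam H t (in_interval_line t) i).
Qed.

Lemma grayson_tangent a b c p : a <> 0 -> b <> 0 -> grayson a b c p ->
  tangent_to (grayson a b c) p (xi a b c p) /\ tangent_to (grayson a b c) p (eta a b p).
Proof.
  intros Ha Hb Hp. split.
  - destruct (xi_integral_curve_exists a b c p Ha Hb) as (gam & H0 & H).
    apply (tangent_of_integral_curve _ (xi a b c) gam); [exact H0 | exact H | |].
    + intros t. apply grayson_iff_energy.
      rewrite (energy_conserved a b c _ _ gam t 0 H (in_interval_line t) (in_interval_line 0)), H0.
      apply grayson_iff_energy, Hp.
    + now apply continuous_xi_along.
  - apply (tangent_of_integral_curve _ (eta a b) (fun t => shift a b t p)).
    + apply coord_ext. intros i. rewrite coord_shift. ring.
    + apply integral_curve_shift.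
    + intros t. apply grayson_iff_energy. rewrite energy_shift. apply grayson_iff_energy, Hp.
    + intros i t. apply continuous_const.
Qed.

Lemma flow_eta_unique a b Psi : is_flow (eta a b) Psi -> forall t p, Psi t p = shift a b t p.
Proof.
  intros H t p. destruct (H p) as [H0 Hc].
  rewrite (integral_curve_eta_shift a b _ _ _ 0 t Hc (in_interval_line 0) (in_interval_line t)).
  rewrite H0, Rminus_0_r. reflexivity.
Qed.

Lemma flow_eta_exists a b : is_flow (eta a b) (shift a b).
Proof.
  intros p. split; [| apply integral_curve_shift].
  apply coord_ext. intros i. rewrite coord_shift. ring.
Qed.

Lemma flow_xi_exists a b c : a <> 0 -> b <> 0 -> exists Phi, is_flow (xi a b c) Phi.
Proof.
  intros Ha Hb.
  exists (fun t p => proj1_sig (constructive_indefinite_description _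
    (xi_integral_curve_exists a b c p Ha Hb)) t).
  intros p. apply (proj2_sig (constructive_indefinite_description _
    (xi_integral_curve_exists a b c p Ha Hb))).
Qed.

(** [xi] is invariant under the translations along the axis, so both sides are integral
    curves of [xi] with the same origin. *)
Lemma flow_xi_shift a b c Phi : a <> 0 -> is_flow (xi a b c) Phi ->
  forall s t p, Phi s (shift a b t p) = shift a b t (Phi s p).
Proof.
  intros Ha H s t p.
  apply (xi_integral_curve_unique a b c (fun s => Phi s (shift a b t p))
    (fun s => shift a b t (Phi s p)) Ha).
  - apply H.
  - intros r Hr i. rewrite xi_shift.
    apply (is_derive_ext (fun r => coord (Phi r p) i + t * coord (axis_direction a b) i)).
    { intros r'. symmetry. apply coord_shift. }
    pose proof (proj2 (H p) r Hr i) as D.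
    pose proof (is_derive_plus (V := R_NormedModule) _ _ r _ _ D
      (is_derive_const (t * coord (axis_direction a b) i) r)) as D'.
    rewrite plus_zero_r in D'. exact D'.
  - rewrite (proj1 (H _)), (proj1 (H p)). reflexivity.
Qed.

Lemma flow_xi_inverse a b c Phi : a <> 0 -> is_flow (xi a b c) Phi ->
  forall t p, Phi t (Phi (- t) p) = p.
Proof.
  intros Ha H t p.
  rewrite (xi_integral_curve_unique a b c (fun s => Phi s (Phi (- t) p))
    (fun s => Phi (s + - t) p) Ha).
  - rewrite Rplus_opp_r. apply H.
  - apply H.
  - intros r _ i.
    pose proof (proj2 (H p) (r + - t) (in_interval_line _) i) as D.
    assert (Dt : is_derive (fun s => s + - t) r 1) by (auto_derive; auto).
    pose proof (is_derive_comp (fun s => coord (Phi s p) i) (fun s => s + - t) r _ _ D Dt) as D'.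
    change (is_derive (fun s => coord (Phi (s + - t) p) i) r
      (1 * coord (xi a b c (Phi (r + - t) p)) i)) in D'.
    rewrite Rmult_1_l in D'. exact D'.
  - rewrite (proj1 (H _)), Rplus_0_l. reflexivity.
Qed.

Lemma set_eq_image_bijection (f g : R3 -> R3) (A : R3 -> Prop) :
  (forall p, A p -> A (f p)) -> (forall p, A p -> A (g p)) -> (forall p, f (g p) = p) ->
  set_eq (image f A) A.
Proof.
  intros Hf Hg Hfg q. split.
  - intros (p & Hp & <-). apply Hf, Hp.
  - intros Hq. exists (g q). split; [apply Hg, Hq | apply Hfg].
Qed.

Lemma flow_xi_grayson a b c Phi t : a <> 0 -> is_flow (xi a b c) Phi ->
  set_eq (image (Phi t) (grayson a b c)) (grayson a b c).
Proof.
  intros Ha H.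
  assert (inv : forall s p, grayson a b c p -> grayson a b c (Phi s p)).
  { intros s p Hp. destruct (H p) as [H0 Hc]. apply grayson_iff_energy.
    rewrite (energy_conserved a b c _ _ _ s 0 Hc (in_interval_line s) (in_interval_line 0)), H0.
    apply grayson_iff_energy, Hp. }
  apply (set_eq_image_bijection _ (Phi (- t))); auto.
  intros p. apply (flow_xi_inverse a b c); assumption.
Qed.

Lemma shift_image_grayson a b c t :
  set_eq (image (shift a b t) (grayson a b c)) (grayson a b c).
Proof.
  apply (set_eq_image_bijection _ (shift a b (- t))).
  - apply shift_grayson.
  - apply shift_grayson.
  - intros p. apply coord_ext. intros i. rewrite !coord_shift. ring.
Qed.

(** * The length of eta, critical and inflection lines *)

Lemma Rabs_mult_pos a b : a <> 0 -> b <> 0 -> 0 < Rabs (a * b).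
Proof.
  intros Ha Hb. apply Rabs_pos_lt, Rmult_integral_contrapositive_currified; assumption.
Qed.

Lemma Rabs_div_pos a b : a <> 0 -> b <> 0 -> 0 < Rabs (b / a).
Proof.
  intros Ha Hb. apply Rabs_pos_lt. unfold Rdiv.
  apply Rmult_integral_contrapositive_currified; [exact Hb | apply Rinv_neq_0_compat, Ha].
Qed.

(** The squared length of [eta] at height z; on the cylinder it equals 1 - u^2. *)
Definition eta_sqnorm (a b z : R) : R := a ^ 2 * exp (2 * z) + b ^ 2 * exp (- 2 * z).

(** At the height of the axis the two exponential terms of the equation of the cylinder are
    both equal to |ab|. *)
Lemma grayson_h_balance a b w : a <> 0 -> b <> 0 ->
  a ^ 2 * exp (2 * (grayson_h a b + w)) = Rabs (a * b) * exp (2 * w) /\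
  b ^ 2 * exp (- 2 * (grayson_h a b + w)) = Rabs (a * b) * exp (- 2 * w).
Proof.
  intros Ha Hb. pose proof (Rabs_div_pos a b Ha Hb) as Hr.
  assert (E : exp (2 * grayson_h a b) = Rabs (b / a)).
  { unfold grayson_h. replace (2 * (/ 2 * ln (Rabs (b / a)))) with (ln (Rabs (b / a))) by lra.
    apply exp_ln, Hr. }
  assert (E' : exp (- 2 * grayson_h a b) = / Rabs (b / a)).
  { replace (- 2 * grayson_h a b) with (- (2 * grayson_h a b)) by ring.
    rewrite exp_Ropp, E. reflexivity. }
  pose proof (Rabs_pos_lt a Ha). pose proof (Rabs_pos_lt b Hb).
  rewrite !Rmult_plus_distr_l, !exp_plus, E, E', Rabs_div, Rabs_mult by exact Ha.
  rewrite <- (pow2_abs a), <- (pow2_abs b).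
  split; field; lra.
Qed.

Lemma eta_sqnorm_balance a b w : a <> 0 -> b <> 0 ->
  eta_sqnorm a b (grayson_h a b + w) = Rabs (a * b) * (exp (2 * w) + exp (- 2 * w)).
Proof.
  intros Ha Hb. unfold eta_sqnorm. destruct (grayson_h_balance a b w Ha Hb) as [-> ->]. ring.
Qed.

Lemma exp_2_opp w : exp (- 2 * w) = / exp (2 * w).
Proof. rewrite <- exp_Ropp. f_equal. ring. Qed.

Lemma inverse_sum_inj T T0 : 0 < T -> 0 < T0 ->
  T + / T = T0 + / T0 -> T = T0 \/ T = / T0.
Proof.
  intros HT HT0 E.
  assert (F : (T - T0) * (T * T0 - 1) = 0).
  { transitivity ((T + / T - (T0 + / T0)) * (T * T0)); [field; lra |]. rewrite E. ring. }
  apply Rmult_integral in F. destruct F as [F | F]; [left; lra | right].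
  apply (Rmult_eq_reg_r T0); [| lra]. rewrite Rinv_l by lra. lra.
Qed.

(** Around the height of the axis the squared length of [eta] is 2 |ab| cosh (2 w), which is
    even and injective on each side. *)
Lemma eta_sqnorm_level a b w w0 : a <> 0 -> b <> 0 ->
  eta_sqnorm a b (grayson_h a b + w) = eta_sqnorm a b (grayson_h a b + w0) <->
  (w = w0 \/ w = - w0).
Proof.
  intros Ha Hb. rewrite !eta_sqnorm_balance by assumption.
  assert (Hr : Rabs (a * b) <> 0) by now apply Rgt_not_eq, Rabs_mult_pos.
  split.
  - intros E. apply Rmult_eq_reg_l in E; [| exact Hr]. rewrite !exp_2_opp in E.
    apply inverse_sum_inj in E; try apply exp_pos. rewrite <- exp_Ropp in E.
    destruct E as [E | E]; apply exp_inv in E; [left | right]; lra.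
  - intros [-> | ->]; [reflexivity |].
    replace (2 * - w0) with (- 2 * w0) by ring. replace (- 2 * - w0) with (2 * w0) by ring. ring.
Qed.

Lemma eta_sqnorm_ge a b z : a <> 0 -> b <> 0 -> 2 * Rabs (a * b) <= eta_sqnorm a b z.
Proof.
  intros Ha Hb. replace z with (grayson_h a b + (z - grayson_h a b)) by ring.
  rewrite eta_sqnorm_balance, exp_2_opp by assumption.
  set (T := exp (2 * (z - grayson_h a b))). assert (HT : 0 < T) by apply exp_pos.
  assert (2 <= T + / T).
  { apply (Rmult_le_reg_r T); [exact HT |]. rewrite Rmult_plus_distr_r, Rinv_l by lra.
    pose proof (pow2_ge_0 (T - 1)). lra. }
  pose proof (Rabs_pos (a * b)). nra.
Qed.

Lemma eta_sqnorm_h a b : a <> 0 -> b <> 0 -> eta_sqnorm a b (grayson_h a b) = 2 * Rabs (a * b).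
Proof.
  intros Ha Hb. rewrite <- (Rplus_0_r (grayson_h a b)), eta_sqnorm_balance by assumption.
  rewrite !Rmult_0_r, exp_0. ring.
Qed.

Lemma eta_sqnorm_eq_min a b z : a <> 0 -> b <> 0 ->
  eta_sqnorm a b z = 2 * Rabs (a * b) <-> z = grayson_h a b.
Proof.
  intros Ha Hb. split; [| intros ->; now apply eta_sqnorm_h].
  rewrite <- (eta_sqnorm_h a b Ha Hb). intros E.
  pose proof (eta_sqnorm_level a b (z - grayson_h a b) 0 Ha Hb) as L.
  rewrite Rplus_0_r in L. replace (grayson_h a b + (z - grayson_h a b)) with z in L by ring.
  apply L in E. lra.
Qed.

(** Since exp (2 arctanh k) = (1 + k) / (1 - k), the value of k is the one for which
    2 |ab| cosh (2 arctanh k) = 1. *)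
Lemma eta_sqnorm_critical a b : a <> 0 -> b <> 0 -> 2 * Rabs (a * b) < 1 ->
  eta_sqnorm a b (grayson_h a b + arctanh (grayson_k a b)) = 1.
Proof.
  intros Ha Hb Hlt. rewrite eta_sqnorm_balance, exp_2_opp by assumption.
  assert (Hr : 0 < Rabs (a * b)) by now apply Rabs_mult_pos.
  set (r := Rabs (a * b)) in *. set (k := grayson_k a b).
  assert (Hk : k ^ 2 = (1 - 2 * r) / (1 + 2 * r)).
  { unfold k, grayson_k. fold r. rewrite pow2_sqrt; [reflexivity |].
    apply Rlt_le, Rdiv_lt_0_compat; lra. }
  assert (Hk' : k ^ 2 * (1 + 2 * r) = 1 - 2 * r) by (rewrite Hk; field; lra).
  assert (Hk0 : 0 <= k) by apply sqrt_pos.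
  assert (Hk1 : k < 1) by nra.
  assert (E : exp (2 * arctanh k) = (1 + k) / (1 - k)).
  { unfold arctanh. replace (2 * (/ 2 * ln ((1 + k) / (1 - k)))) with (ln ((1 + k) / (1 - k))) by lra.
    apply exp_ln, Rdiv_lt_0_compat; lra. }
  rewrite E.
  assert (Hd : 0 < 1 - k ^ 2) by nra.
  apply (Rmult_eq_reg_r ((1 - k) * (1 + k))); [| nra].
  transitivity (r * ((1 + k) ^ 2 + (1 - k) ^ 2)); [field; lra |]. lra.
Qed.

Lemma grayson_sqnorm a b c x y z :
  grayson a b c (x, y, z) <-> (a * x - b * y - c) ^ 2 + eta_sqnorm a b z = 1.
Proof. unfold grayson, eta_sqnorm. rewrite Rplus_assoc. reflexivity. Qed.

Lemma critical_lines_eq a b c : a <> 0 -> b <> 0 -> 2 * Rabs (a * b) < 1 ->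
  set_eq (critical_lines a b c)
    (fun p => grayson a b c p /\ a * coord p Ix - b * coord p Iy = c).
Proof.
  intros Ha Hb Hlt [[x y] z]. rewrite grayson_sqnorm. simpl.
  pose proof (eta_sqnorm_level a b (z - grayson_h a b) (arctanh (grayson_k a b)) Ha Hb) as L.
  rewrite eta_sqnorm_critical in L by assumption.
  replace (grayson_h a b + (z - grayson_h a b)) with z in L by ring.
  rewrite <- L. clear L. split; intros [E1 E2]; split; try exact E2.
  - replace (a * x - b * y - c) with 0 by lra. lra.
  - replace (a * x - b * y - c) with 0 in E1 by lra. lra.
Qed.

Lemma inflection_lines_eq a b c : a <> 0 -> b <> 0 -> 2 * Rabs (a * b) < 1 ->
  set_eq (inflection_lines a b c)
    (fun p => grayson a b c p /\ coord p Iz = grayson_h a b).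
Proof.
  intros Ha Hb Hlt [[x y] z]. rewrite grayson_sqnorm.
  unfold inflection_lines, inflection_line_plus, inflection_line_minus. simpl coord.
  assert (Hs : sqrt (1 - 2 * Rabs (a * b)) ^ 2 = 1 - 2 * Rabs (a * b))
    by (apply pow2_sqrt; lra).
  set (s := sqrt (1 - 2 * Rabs (a * b))) in *.
  split.
  - intros [[-> E] | [-> E]]; (split; [| reflexivity]); rewrite E, eta_sqnorm_h by assumption.
    + replace (c + s - c) with s by ring. lra.
    + replace (c - s - c) with (- s) by ring. lra.
  - intros [E ->]. rewrite eta_sqnorm_h in E by assumption.
    assert (F : (a * x - b * y - c - s) * (a * x - b * y - c + s) = 0) by lra.
    apply Rmult_integral in F. destruct F; [left | right]; split; lra.
Qed.

(** * Integral curves of eta *)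

Definition eta_line (a b h d : R) : R3 -> Prop := fun '(x, y, z) => z = h /\ a * x - b * y = d.

Lemma eta_line_eq a b h d p : a <> 0 -> eta_line a b h d p ->
  set_eq (eta_line a b h d) (line p (axis_direction a b)).
Proof.
  intros Ha Hp q. destruct p as [[x0 y0] z0]. destruct Hp as [-> Ed].
  split.
  - destruct q as [[x y] z]. intros [-> E]. exists ((y - y0) / a).
    apply coord_ext. intros []; simpl.
    + apply (Rmult_eq_reg_l a); [| exact Ha].
      transitivity (a * x0 + b * (y - y0)); [lra | field; exact Ha].
    + field. exact Ha.
    + ring.
  - intros [s ->]. simpl. split; lra.
Qed.

(** A horizontal line has zero coordinate acceleration, so it is a geodesic exactly when
    its Christoffel term b^2 exp (- 2 z) - a^2 exp (2 z) vanishes. *)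
Lemma eta_geodesic_iff a b al be gam t0 : a <> 0 -> b <> 0 ->
  integral_curve (eta a b) al be gam -> in_interval al be t0 ->
  sol_geodesic al be gam <-> coord (gam t0) Iz = grayson_h a b.
Proof.
  intros Ha Hb H Ht0.
  set (v := axis_direction a b).
  assert (D1 : forall t, in_interval al be t -> forall k,
    Derive (fun r => coord (gam r) k) t = coord v k)
    by (intros t Ht k; apply is_derive_unique, (H t Ht k)).
  assert (D2 : forall t, in_interval al be t -> forall k,
    is_derive (Derive (fun r => coord (gam r) k)) t 0).
  { intros t Ht k. apply (is_derive_ext_loc (fun _ => coord v k)); [| apply @is_derive_const].
    apply (filter_imp (fun s => in_interval al be s)); [| now apply locally_in_interval].
    intros s Hs. symmetry. now apply D1. }
  assert (Hz : forall t, in_interval al be t -> coord (gam t) Iz = coord (gam t0) Iz).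
  { intros t Ht. rewrite (integral_curve_eta_shift a b al be gam t0 t H Ht0 Ht). apply shift_z. }
  assert (Hbal : forall z, b ^ 2 * exp (- 2 * z) = a ^ 2 * exp (2 * z) <-> z = grayson_h a b).
  { intros z. destruct (grayson_h_balance a b (z - grayson_h a b) Ha Hb) as [E1 E2].
    replace (grayson_h a b + (z - grayson_h a b)) with z in E1, E2 by ring.
    assert (Hr : Rabs (a * b) <> 0) by now apply Rgt_not_eq, Rabs_mult_pos.
    rewrite E1, E2. split.
    - intros E. apply Rmult_eq_reg_l in E; [| exact Hr]. apply exp_inv in E. lra.
    - intros ->. do 2 f_equal. ring. }
  assert (G : forall t k, sum3 (fun i => sum3 (fun j =>
      christoffel sol_metric sol_cometric (gam t) k i j * coord v i * coord v j))
    = match k with Iz => b ^ 2 * exp (- 2 * coord (gam t) Iz) - a ^ 2 * exp (2 * coord (gam t) Iz)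
      | _ => 0 end).
  { intros t k. unfold sum3. rewrite !christoffel_sol. destruct k; simpl; ring. }
  split.
  - intros Hg. destruct (Hg t0 Ht0 Iz) as (_ & _ & E).
    rewrite (is_derive_unique _ _ _ (D2 t0 Ht0 Iz)) in E.
    unfold sum3 in E, G. rewrite !D1 in E by exact Ht0. rewrite G in E. apply Hbal. lra.
  - intros E t Ht k.
    split; [exists (coord v k); apply (H t Ht k) |].
    split; [exists 0; now apply D2 |].
    rewrite (is_derive_unique _ _ _ (D2 t Ht k)).
    unfold sum3 in *. rewrite !D1 by exact Ht. rewrite G, Hz by exact Ht.
    apply Hbal in E. destruct k; lra.
Qed.

Lemma set_eq_sym A B : set_eq A B -> set_eq B A.
Proof. intros H p. symmetry. apply H. Qed.

Lemma axis_direction_neq0 a b : b <> 0 -> axis_direction a b <> vzero.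
Proof. intros Hb E. injection E. auto. Qed.

Lemma line_shift a b p t : line p (axis_direction a b) (shift a b t p).
Proof. exists t. reflexivity. Qed.

(** On the cylinder the height of the axis is reached only on the two inflection lines, so
    the criterion on the height becomes one on the line. *)
Lemma eta_curve_line a b c al be gam t0 : a <> 0 -> b <> 0 -> 2 * Rabs (a * b) < 1 ->
  integral_curve (eta a b) al be gam -> in_interval al be t0 -> grayson a b c (gam t0) ->
  exists L : R3 -> Prop,
    horizontal_line L /\ subset L (grayson a b c) /\ parallel_lines L (axis_line a b c) /\
    (forall t, in_interval al be t -> L (gam t)) /\
    (al = m_infty -> be = p_infty -> set_eq (trajectory gam) L) /\
    (sol_geodesic al be gam <->
       set_eq L (inflection_line_plus a b c) \/ set_eq L (inflection_line_minus a b c)).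
Proof.
  intros Ha Hb Hlt H Ht0 HG. set (p := gam t0) in *.
  pose proof (axis_direction_neq0 a b Hb) as Hv.
  exists (line p (axis_direction a b)).
  split; [| split; [| split; [| split; [| split]]]].
  - exists p, (axis_direction a b). split; [exact Hv |]. split; [reflexivity |]. intros q; reflexivity.
  - intros q [s ->]. apply (shift_grayson a b c s p HG).
  - exists p, (c / a, 0, grayson_h a b), (axis_direction a b).
    split; [exact Hv |]. split; [intros q; reflexivity |].
    apply (eta_line_eq a b (grayson_h a b) c); [exact Ha |]. split; [reflexivity | field; exact Ha].
  - intros t Ht. rewrite (integral_curve_eta_shift a b al be gam t0 t H Ht0 Ht). apply line_shift.
  - intros -> -> q. split.
    + intros [t <-]. rewrite (integral_curve_eta_shift a b _ _ gam t0 t H Ht0 (in_interval_line t)).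
      apply line_shift.
    + intros [s ->]. exists (t0 + s).
      rewrite (integral_curve_eta_shift a b _ _ gam t0 (t0 + s) H Ht0 (in_interval_line _)).
      replace (t0 + s - t0) with s by ring. reflexivity.
  - rewrite (eta_geodesic_iff a b al be gam t0 Ha Hb H Ht0). fold p.
    assert (Hp : line p (axis_direction a b) p).
    { exists 0. apply coord_ext. intros i.
      change (coord p i = coord (shift a b 0 p) i). rewrite coord_shift. ring. }
    split.
    + intros E. assert (HI : inflection_lines a b c p) by (apply inflection_lines_eq; auto).
      destruct HI as [HI | HI]; [left | right]; apply set_eq_sym, (eta_line_eq a b (grayson_h a b));
        try exact Ha; exact HI.
    + intros [HL | HL]; apply HL in Hp; destruct p as [[x y] z]; apply Hp.
Qed.

(** * The angle between xi and eta *)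

(** The scalar product of [xi] and [eta] is the constant 2ab, and [xi] has length 1 on the
    cylinder, because its squared length is the function whose level 1 is the cylinder. *)
Lemma cos_angle_formula a b c p : a <> 0 -> b <> 0 -> 2 * Rabs (a * b) < 1 -> grayson a b c p ->
  cos (sol_angle p (xi a b c p) (eta a b p)) = 2 * (a * b) / sqrt (eta_sqnorm a b (coord p Iz)).
Proof.
  intros Ha Hb Hlt HG. destruct p as [[x y] z]. apply grayson_sqnorm in HG. simpl coord.
  pose proof (eta_sqnorm_ge a b z Ha Hb) as HN.
  assert (Hr : 0 < Rabs (a * b)) by now apply Rabs_mult_pos.
  unfold sol_angle, angle, rnorm.
  pose proof (exp_opp2 z) as Hinv.
  assert (I1 : inner sol_metric (x, y, z) (xi a b c (x, y, z)) (eta a b (x, y, z)) = 2 * (a * b)).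
  { unfold inner, sum3; simpl.
    transitivity (2 * (a * b) * (exp (2 * z) * exp (- 2 * z))); [ring | rewrite Hinv; ring]. }
  assert (I2 : inner sol_metric (x, y, z) (xi a b c (x, y, z)) (xi a b c (x, y, z)) = 1).
  { rewrite <- HG. unfold inner, sum3, eta_sqnorm; simpl.
    transitivity (a ^ 2 * exp (2 * z) * (exp (2 * z) * exp (- 2 * z))
      + b ^ 2 * exp (- 2 * z) * (exp (2 * z) * exp (- 2 * z)) + (a * x - b * y - c) ^ 2);
      [ring | rewrite Hinv; ring]. }
  assert (I3 : inner sol_metric (x, y, z) (eta a b (x, y, z)) (eta a b (x, y, z))
      = eta_sqnorm a b z) by (unfold inner, sum3, eta_sqnorm; simpl; ring).
  rewrite I1, I2, I3, sqrt_1, Rmult_1_l.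
  set (N := eta_sqnorm a b z) in *.
  assert (Hs : 0 < sqrt N) by (apply sqrt_lt_R0; lra).
  assert (Hs2 : sqrt N * sqrt N = N) by (apply sqrt_sqrt; lra).
  assert (Hle : 2 * Rabs (a * b) <= sqrt N) by nra.
  apply cos_acos, Rabs_le_between.
  rewrite Rabs_div by lra. rewrite (Rabs_pos_eq (sqrt N)), Rabs_mult, (Rabs_pos_eq 2) by lra.
  apply (Rmult_le_reg_r (sqrt N)); [exact Hs |].
  replace (2 * Rabs (a * b) / sqrt N * sqrt N) with (2 * Rabs (a * b)) by (field; lra). lra.
Qed.

Lemma grayson_sqnorm_le1 a b c p : grayson a b c p -> eta_sqnorm a b (coord p Iz) <= 1.
Proof.
  destruct p as [[x y] z]. rewrite grayson_sqnorm. simpl. intros H.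
  pose proof (pow2_ge_0 (a * x - b * y - c)). unfold eta_sqnorm in *. simpl in *. lra.
Qed.

Lemma abs_cos_angle a b c p : a <> 0 -> b <> 0 -> 2 * Rabs (a * b) < 1 -> grayson a b c p ->
  Rabs (cos (sol_angle p (xi a b c p) (eta a b p)))
  = 2 * Rabs (a * b) / sqrt (eta_sqnorm a b (coord p Iz)).
Proof.
  intros Ha Hb Hlt HG. rewrite (cos_angle_formula a b c p) by assumption.
  pose proof (eta_sqnorm_ge a b (coord p Iz) Ha Hb) as HN.
  assert (Hr : 0 < Rabs (a * b)) by now apply Rabs_mult_pos.
  assert (Hs : 0 < sqrt (eta_sqnorm a b (coord p Iz))) by (apply sqrt_lt_R0; lra).
  rewrite Rabs_div by lra. rewrite (Rabs_pos_eq (sqrt _)), Rabs_mult, (Rabs_pos_eq 2) by lra.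
  reflexivity.
Qed.

Lemma abs_cos_angle_bounds a b c p : a <> 0 -> b <> 0 -> 2 * Rabs (a * b) < 1 -> grayson a b c p ->
  2 * Rabs (a * b) <= Rabs (cos (sol_angle p (xi a b c p) (eta a b p))) <= sqrt (2 * Rabs (a * b)).
Proof.
  intros Ha Hb Hlt HG. rewrite (abs_cos_angle a b c p) by assumption.
  pose proof (eta_sqnorm_ge a b (coord p Iz) Ha Hb) as HN.
  pose proof (grayson_sqnorm_le1 a b c p HG) as HN1.
  assert (Hr : 0 < Rabs (a * b)) by now apply Rabs_mult_pos.
  set (N := eta_sqnorm a b (coord p Iz)) in *.
  assert (Ht : 0 < sqrt (2 * Rabs (a * b))) by (apply sqrt_lt_R0; lra).
  assert (Hts : sqrt (2 * Rabs (a * b)) <= sqrt N) by (apply sqrt_le_1_alt, HN).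
  assert (Hs1 : sqrt N <= 1) by (rewrite <- sqrt_1; apply sqrt_le_1_alt, HN1).
  assert (Ht2 : sqrt (2 * Rabs (a * b)) * sqrt (2 * Rabs (a * b)) = 2 * Rabs (a * b))
    by (apply sqrt_sqrt; lra).
  assert (Hq : 2 * Rabs (a * b) / sqrt N * sqrt N = 2 * Rabs (a * b)) by (field; lra).
  split; apply (Rmult_le_reg_r (sqrt N)); try lra; rewrite Hq; nra.
Qed.

Lemma abs_cos_angle_le_iff a b c p q : a <> 0 -> b <> 0 -> 2 * Rabs (a * b) < 1 ->
  grayson a b c p -> grayson a b c q ->
  Rabs (cos (sol_angle p (xi a b c p) (eta a b p)))
    <= Rabs (cos (sol_angle q (xi a b c q) (eta a b q))) <->
  eta_sqnorm a b (coord q Iz) <= eta_sqnorm a b (coord p Iz).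
Proof.
  intros Ha Hb Hlt Hp Hq. rewrite !(abs_cos_angle a b c) by assumption.
  pose proof (eta_sqnorm_ge a b (coord p Iz) Ha Hb) as HNp.
  pose proof (eta_sqnorm_ge a b (coord q Iz) Ha Hb) as HNq.
  assert (Hr : 0 < Rabs (a * b)) by now apply Rabs_mult_pos.
  set (M := eta_sqnorm a b (coord p Iz)) in *. set (N := eta_sqnorm a b (coord q Iz)) in *.
  assert (HM : 0 < sqrt M) by (apply sqrt_lt_R0; lra).
  assert (HN : 0 < sqrt N) by (apply sqrt_lt_R0; lra).
  split.
  - intros E. apply sqrt_le_0; [lra | lra |].
    apply (Rmult_le_compat_r (sqrt M * sqrt N)) in E; [| nra].
    replace (2 * Rabs (a * b) / sqrt M * (sqrt M * sqrt N)) with (2 * Rabs (a * b) * sqrt N)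
      in E by (field; lra).
    replace (2 * Rabs (a * b) / sqrt N * (sqrt M * sqrt N)) with (2 * Rabs (a * b) * sqrt M)
      in E by (field; lra).
    apply Rmult_le_reg_l in E; lra.
  - intros E. apply Rmult_le_compat_l; [lra |]. apply Rinv_le_contravar; [exact HN |].
    apply sqrt_le_1_alt, E.
Qed.

Lemma sign_cos_angle a b c p : a <> 0 -> b <> 0 -> 2 * Rabs (a * b) < 1 -> grayson a b c p ->
  sign (cos (sol_angle p (xi a b c p) (eta a b p))) = sign (a * b).
Proof.
  intros Ha Hb Hlt HG. rewrite (cos_angle_formula a b c p) by assumption.
  pose proof (eta_sqnorm_ge a b (coord p Iz) Ha Hb) as HN.
  assert (Hr : 0 < Rabs (a * b)) by now apply Rabs_mult_pos.
  assert (Hs : 0 < sqrt (eta_sqnorm a b (coord p Iz))) by (apply sqrt_lt_R0; lra).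
  unfold Rdiv. rewrite sign_mult, (sign_mult 2), (sign_eq_1 2), (sign_eq_1 (/ _));
    [ring | now apply Rinv_0_lt_compat | lra].
Qed.

Lemma critical_point_exists a b c : a <> 0 -> b <> 0 -> 2 * Rabs (a * b) < 1 ->
  exists p, critical_lines a b c p.
Proof.
  intros Ha Hb Hlt. exists (c / a, 0, grayson_h a b + arctanh (grayson_k a b)).
  split; [left; ring | field; exact Ha].
Qed.

Lemma inflection_point_exists a b c : a <> 0 -> exists p, inflection_lines a b c p.
Proof.
  intros Ha. exists ((c + sqrt (1 - 2 * Rabs (a * b))) / a, 0, grayson_h a b).
  left. split; [reflexivity | field; exact Ha].
Qed.

Lemma critical_lines_sqnorm a b c p : a <> 0 -> b <> 0 -> 2 * Rabs (a * b) < 1 ->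
  critical_lines a b c p <-> grayson a b c p /\ eta_sqnorm a b (coord p Iz) = 1.
Proof.
  intros Ha Hb Hlt. rewrite (critical_lines_eq a b c Ha Hb Hlt p).
  destruct p as [[x y] z]. rewrite grayson_sqnorm. simpl coord.
  split; intros [E1 E2]; split; try exact E1.
  - replace (a * x - b * y - c) with 0 in E1 by lra. lra.
  - assert (F : (a * x - b * y - c) * (a * x - b * y - c) = 0) by lra.
    apply Rmult_integral in F. lra.
Qed.

Lemma inflection_lines_sqnorm a b c p : a <> 0 -> b <> 0 -> 2 * Rabs (a * b) < 1 ->
  inflection_lines a b c p <->
  grayson a b c p /\ eta_sqnorm a b (coord p Iz) = 2 * Rabs (a * b).
Proof.
  intros Ha Hb Hlt. rewrite (inflection_lines_eq a b c Ha Hb Hlt p).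
  rewrite eta_sqnorm_eq_min by assumption. reflexivity.
Qed.

Lemma abs_cos_angle_minimal a b c : a <> 0 -> b <> 0 -> 2 * Rabs (a * b) < 1 ->
  let f p := Rabs (cos (sol_angle p (xi a b c p) (eta a b p))) in
  set_eq (fun p => grayson a b c p /\ forall q, grayson a b c q -> f p <= f q)
    (critical_lines a b c).
Proof.
  intros Ha Hb Hlt f p. rewrite critical_lines_sqnorm by assumption.
  split; intros [Hp H]; split; try exact Hp.
  - destruct (critical_point_exists a b c Ha Hb Hlt) as [q Hq].
    apply critical_lines_sqnorm in Hq; try assumption. destruct Hq as [Hq E].
    pose proof (H q Hq) as L. apply abs_cos_angle_le_iff in L; try assumption.
    pose proof (grayson_sqnorm_le1 a b c p Hp). lra.
  - intros q Hq. apply abs_cos_angle_le_iff; try assumption.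
    rewrite H. apply (grayson_sqnorm_le1 a b c q Hq).
Qed.

Lemma abs_cos_angle_maximal a b c : a <> 0 -> b <> 0 -> 2 * Rabs (a * b) < 1 ->
  let f p := Rabs (cos (sol_angle p (xi a b c p) (eta a b p))) in
  set_eq (fun p => grayson a b c p /\ forall q, grayson a b c q -> f q <= f p)
    (inflection_lines a b c).
Proof.
  intros Ha Hb Hlt f p. rewrite inflection_lines_sqnorm by assumption.
  split; intros [Hp H]; split; try exact Hp.
  - destruct (inflection_point_exists a b c Ha) as [q Hq].
    apply inflection_lines_sqnorm in Hq; try assumption. destruct Hq as [Hq E].
    pose proof (H q Hq) as L. apply abs_cos_angle_le_iff in L; try assumption.
    pose proof (eta_sqnorm_ge a b (coord p Iz) Ha Hb). lra.
  - intros q Hq. apply abs_cos_angle_le_iff; try assumption.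
    rewrite H. now apply eta_sqnorm_ge.
Qed.

Lemma cos_lipschitz x y : Rabs (cos x - cos y) <= Rabs (x - y).
Proof.
  destruct (MVT_gen cos y x (fun t => - sin t)) as (r & _ & ->).
  - intros t _. auto_derive; auto; ring.
  - intros t _. apply continuity_cos.
  - rewrite Rabs_mult, Rabs_Ropp.
    assert (Rabs (sin r) <= 1) by (apply Rabs_le; pose proof (SIN_bound r); lra).
    pose proof (Rabs_pos (x - y)). nra.
Qed.

(** The cosine is 1-Lipschitz and takes the values 1, 0, -1 at 0, pi / 2, pi. *)
Lemma angle_separation lo hi x : lo <= Rabs (cos x) -> Rabs (cos x) <= hi ->
  let delta := Rmin lo (1 - hi) in
  delta <= Rabs (x - 0) /\ delta <= Rabs (x - PI / 2) /\ delta <= Rabs (x - PI).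
Proof.
  intros Hlo Hhi delta.
  pose proof (cos_lipschitz x 0) as C0. pose proof (cos_lipschitz x (PI / 2)) as C1.
  pose proof (cos_lipschitz x PI) as C2. rewrite cos_0 in C0. rewrite cos_PI2 in C1.
  rewrite cos_PI in C2.
  assert (D1 : delta <= lo) by apply Rmin_l. assert (D2 : delta <= 1 - hi) by apply Rmin_r.
  rewrite Rminus_0_r in C1.
  pose proof (Rabs_triang_inv 1 (cos x)) as T1. rewrite Rabs_R1, Rabs_minus_sym in T1.
  pose proof (Rabs_triang_inv (-1) (cos x)) as T2.
  rewrite Rabs_minus_sym in T2. replace (Rabs (-1)) with 1 in T2 by (rewrite Rabs_left; lra).
  repeat split; lra.
Qed.

(** * Isometries preserve the connection *)

Definition kron (i j : axis3) : R :=
  match i, j with Ix, Ix | Iy, Iy | Iz, Iz => 1 | _, _ => 0 end.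

Definition next3 (i : axis3) : axis3 :=
  match i with Ix => Iy | Iy => Iz | Iz => Ix end.

(** The cofactors are taken with cyclic indices, which absorbs their signs. *)
Definition adj3 (A : axis3 -> axis3 -> R) (i j : axis3) : R :=
  A (next3 j) (next3 i) * A (next3 (next3 j)) (next3 (next3 i))
  - A (next3 j) (next3 (next3 i)) * A (next3 (next3 j)) (next3 i).

Definition det3 (A : axis3 -> axis3 -> R) : R :=
  sum3 (fun j => adj3 A Ix j * A j Ix).

Lemma adj3_mul (A : axis3 -> axis3 -> R) (i k : axis3) :
  sum3 (fun j => adj3 A i j * A j k) = det3 A * kron i k.
Proof.
  destruct i, k; unfold det3, sum3, adj3, kron, next3; ring.
Qed.

Lemma det3_mul (A B : axis3 -> axis3 -> R) :
  det3 (fun i k => sum3 (fun j => A i j * B j k)) = det3 A * det3 B.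
Proof. unfold det3, sum3, adj3, next3; ring. Qed.

Lemma det3_ext (A B : axis3 -> axis3 -> R) :
  (forall i k, A i k = B i k) -> det3 A = det3 B.
Proof. intros H. unfold det3, sum3, adj3. rewrite !H. reflexivity. Qed.

(** This is what turns the statement that the differential of an isometry preserves the
    metric into the dual statement about the inverse metric. *)
Lemma right_inverse_left (A B : axis3 -> axis3 -> R) :
  (forall i k, sum3 (fun j => A i j * B j k) = kron i k) ->
  forall i k, sum3 (fun j => B i j * A j k) = kron i k.
Proof.
  intros HAB.
  assert (Hdet : det3 A * det3 B = 1).
  { rewrite <- det3_mul, (det3_ext _ kron HAB).
    unfold det3, sum3, adj3, kron, next3. ring. }
  assert (HdA : det3 A <> 0) by (intros H0; rewrite H0 in Hdet; lra).
  (* B is the adjugate of A divided by the determinant, because adj A = (adj A A) B. *)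
  assert (HB : forall i k, det3 A * B i k = adj3 A i k).
  { intros i k.
    transitivity (sum3 (fun j => adj3 A i j * kron j k)).
    - unfold sum3. rewrite <- !HAB.
      transitivity (sum3 (fun j => sum3 (fun l => adj3 A i l * A l j) * B j k)).
      + unfold sum3 at 1. rewrite !adj3_mul. destruct i; unfold kron; ring.
      + unfold sum3; ring.
    - destruct k; unfold sum3, kron; ring. }
  intros i k. apply (Rmult_eq_reg_l (det3 A)); [| exact HdA].
  rewrite <- adj3_mul. unfold sum3. rewrite <- !HB. ring.
Qed.

Definition jac (phi : R3 -> R3) (p : R3) (i l : axis3) : R :=
  partial i (fun q => coord (phi q) l) p.

Definition basis3 (i : axis3) : R3 := (kron Ix i, kron Iy i, kron Iz i).

Lemma coord_differential phi p v l :
  coord (Defs.differential phi p v) l = sum3 (fun i => jac phi p i l * coord v i).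
Proof. destruct l; reflexivity. Qed.

Lemma coord_differential_basis phi p i l :
  coord (Defs.differential phi p (basis3 i)) l = jac phi p i l.
Proof.
  rewrite coord_differential. unfold sum3, basis3, coord, kron. destruct i; ring.
Qed.

Lemma isometry_gram phi p i j :
  sol_isometry phi ->
  sum3 (fun l => sol_metric (phi p) l l * (jac phi p i l * jac phi p j l))
  = sol_metric p i j.
Proof.
  intros [_ H]. specialize (H p (basis3 i) (basis3 j)).
  unfold inner in H. unfold sum3 in H.
  rewrite !coord_differential_basis in H.
  transitivity (sol_metric p i j * 1); [| ring].
  destruct i, j; unfold sum3; simpl in *; lra.
Qed.

Lemma isometry_gram_dual phi p l m :
  sol_isometry phi ->
  sum3 (fun i => sol_cometric p i i * (jac phi p i l * jac phi p i m))
  * sol_metric (phi p) l l = kron l m.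
Proof.
  intros H.
  pose proof (right_inverse_left (fun i l => jac phi p i l)
    (fun l i => sol_metric (phi p) l l * jac phi p i l * sol_cometric p i i)) as HH.
  rewrite <- HH.
  - unfold sum3; ring.
  - intros i k.
    transitivity (sol_metric p i k * sol_cometric p k k).
    + rewrite <- (isometry_gram phi p i k H). unfold sum3; ring.
    + pose proof (exp_opp2 (coord p Iz)). destruct i, k; simpl; lra.
Qed.

Lemma isometry_nondegenerate phi p (v : axis3 -> R) :
  sol_isometry phi ->
  (forall k, sum3 (fun l => sol_metric (phi p) l l * jac phi p k l * v l) = 0) ->
  forall m, v m = 0.
Proof.
  intros H Hv m.
  transitivity (sum3 (fun l => kron l m * v l)).
  { destruct m; unfold sum3, kron; ring. }
  unfold sum3 at 1. rewrite <- !(isometry_gram_dual phi p _ m H).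
  transitivity (sum3 (fun i => sol_cometric p i i * jac phi p i m *
    sum3 (fun l => sol_metric (phi p) l l * jac phi p i l * v l))).
  - unfold sum3; ring.
  - unfold sum3 at 1. rewrite !Hv. ring.
Qed.

Definition hess (phi : R3 -> R3) (p : R3) (i j l : axis3) : R :=
  partial i (fun q => jac phi q j l) p.

Lemma isometry_smooth phi l : sol_isometry phi -> class_C 2 (fun q => coord (phi q) l).
Proof. intros [[H _] _]. apply (H 2%nat l). Qed.

Lemma hess_sym phi p i j l : sol_isometry phi -> hess phi p i j l = hess phi p j i l.
Proof. intros H. apply partial_comm, isometry_smooth, H. Qed.

Lemma is_derive_component phi p i l : sol_isometry phi ->
  is_derive (fun s => coord (phi (upd p i s)) l) (coord p i) (jac phi p i l).
Proof.
  intros H. apply (is_derive_partial (fun q => coord (phi q) l)).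
  exact (proj1 (proj2 (isometry_smooth phi l H) i) p).
Qed.

Lemma is_derive_jac phi p i j l : sol_isometry phi ->
  is_derive (fun s => jac phi (upd p i s) j l) (coord p i) (hess phi p i j l).
Proof.
  intros H. apply (is_derive_partial (fun q => jac phi q j l)).
  exact (proj1 (proj2 (proj2 (proj2 (isometry_smooth phi l H) j)) i) p).
Qed.

Lemma is_derive_metric_along phi p i l : sol_isometry phi ->
  is_derive (fun s => sol_metric (phi (upd p i s)) l l) (coord p i)
    (jac phi p i Iz * sol_dmetric (phi p) Iz l l).
Proof.
  intros H. pose proof (is_derive_component phi p i Iz H) as Hz.
  assert (Hc : forall c, is_derive (fun s => exp (c * coord (phi (upd p i s)) Iz))
     (coord p i) (jac phi p i Iz * (c * exp (c * coord (phi p) Iz)))).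
  { intros c. pose proof (is_derive_exp_scale _ _ _ c Hz) as He.
    cbv beta in He. rewrite upd_coord in He. exact He. }
  destruct l; simpl; [apply Hc | apply Hc |].
  rewrite Rmult_0_r. apply (is_derive_const 1).
Qed.

(** The Koszul formula: three differentiated copies of the identity of [isometry_gram],
    combined with the symmetry of the second derivatives, give the scalar products of the
    covariant derivatives of the columns of the Jacobian matrix with these columns. *)
Lemma koszul phi p i j k : sol_isometry phi ->
  sum3 (fun l => sol_metric (phi p) l l * jac phi p k l *
    (hess phi p i j l
     + sum3 (fun m => sum3 (fun n => sol_christoffel (phi p) l m n * jac phi p i m * jac phi p j n))))
  = / 2 * (sol_dmetric p i j k + sol_dmetric p j i k - sol_dmetric p k i j).
Proof.
  intros H.
  (* The derivative of the identity of isometry_gram along the k-th coordinate. *)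
  assert (key : forall i j k, sum3 (fun l =>
    jac phi p k Iz * sol_dmetric (phi p) Iz l l * (jac phi p i l * jac phi p j l)
    + sol_metric (phi p) l l *
      (hess phi p k i l * jac phi p j l + jac phi p i l * hess phi p k j l))
    = sol_dmetric p k i j).
  { clear i j k. intros i j k.
    rewrite <- partial_sol_metric. symmetry. apply is_derive_unique.
    apply (is_derive_ext (fun s => sum3 (fun l => sol_metric (phi (upd p k s)) l l *
      (jac phi (upd p k s) i l * jac phi (upd p k s) j l)))).
    { intros s. apply isometry_gram, H. }
    unfold sum3.
    assert (Hl : forall l, is_derive (fun s => sol_metric (phi (upd p k s)) l l *
      (jac phi (upd p k s) i l * jac phi (upd p k s) j l)) (coord p k)
      (jac phi p k Iz * sol_dmetric (phi p) Iz l l * (jac phi p i l * jac phi p j l)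
       + sol_metric (phi p) l l *
         (hess phi p k i l * jac phi p j l + jac phi p i l * hess phi p k j l))).
    { intros l. apply is_derive_prod3; [apply is_derive_metric_along, H | apply is_derive_jac, H
        | apply is_derive_jac, H | rewrite upd_coord; auto]. }
    exact (is_derive_plus _ _ _ _ _ (is_derive_plus _ _ _ _ _ (Hl Ix) (Hl Iy)) (Hl Iz)). }
  rewrite <- !key.
  unfold sum3. rewrite !(fun l => hess_sym phi p k i l H), !(fun l => hess_sym phi p k j l H),
    !(fun l => hess_sym phi p j i l H).
  simpl. field.
Qed.

(** Isometries preserve the Levi-Civita connection, in coordinates: the second derivatives
    of phi are expressed by its first derivatives. *)
Lemma hess_christoffel phi p i j l : sol_isometry phi ->
  hess phi p i j l
  + sum3 (fun m => sum3 (fun n => sol_christoffel (phi p) l m n * jac phi p i m * jac phi p j n))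
  = sum3 (fun m => sol_christoffel p m i j * jac phi p m l).
Proof.
  intros H. apply Rminus_diag_uniq.
  apply (isometry_nondegenerate phi p (fun l => hess phi p i j l
    + sum3 (fun m => sum3 (fun n => sol_christoffel (phi p) l m n * jac phi p i m * jac phi p j n))
    - sum3 (fun m => sol_christoffel p m i j * jac phi p m l)) H).
  intros k.
  pose proof (koszul phi p i j k H) as Hk.
  rewrite sol_christoffel_lower in Hk.
  assert (Hr : sum3 (fun m => sol_christoffel p m i j * sol_metric p m k) =
    sum3 (fun m => sol_christoffel p m i j * sum3 (fun l =>
      sol_metric (phi p) l l * (jac phi p m l * jac phi p k l)))).
  { unfold sum3 at 1. rewrite <- !(fun m => isometry_gram phi p m k H). reflexivity. }
  rewrite Hr in Hk.
  apply Rminus_diag_eq in Hk. rewrite <- Hk. unfold sum3. ring.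
Qed.

(** * Killing fields of SOL *)

(** The equation says that the Lie derivative of the metric along W vanishes. *)
Definition killing_field (g : tensor2) (W : R3 -> R3) : Prop :=
  (forall p i k, ex_partial i (fun q => coord (W q) k) p) /\
  forall p i j, sum3 (fun k =>
    coord (W p) k * partial k (fun q => g q i j) p
    + g p k j * partial i (fun q => coord (W q) k) p
    + g p i k * partial j (fun q => coord (W q) k) p) = 0.

(** The preimage under the differential of phi of the coordinate field number l. The metric
    is diagonal and phi preserves it, so the inverse of the differential is its adjoint, and
    no inverse matrix is needed. *)
Definition pullback_field (phi : R3 -> R3) (l : axis3) (p : R3) : R3 :=
  let w i := sol_cometric p i i * (sol_metric (phi p) l l * jac phi p i l) in
  (w Ix, w Iy, w Iz).

Lemma coord_pullback_field phi l p k : coord (pullback_field phi l p) k =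
  sol_cometric p k k * (sol_metric (phi p) l l * jac phi p k l).
Proof. destruct k; reflexivity. Qed.

Definition sol_dcometric (p : R3) (i k : axis3) : R :=
  match i, k with
  | Iz, Ix => 2 * exp (2 * coord p Iz)
  | Iz, Iy => - 2 * exp (- 2 * coord p Iz)
  | _, _ => 0
  end.

Lemma is_derive_sol_cometric (p : R3) (i k : axis3) :
  is_derive (fun s => sol_cometric (upd p i s) k k) (coord p i) (sol_dcometric p i k).
Proof.
  destruct p as [[x y] z], i, k; simpl; auto_derive; auto; ring.
Qed.

Lemma is_derive_pullback_field phi l p i k : sol_isometry phi ->
  is_derive (fun s => coord (pullback_field phi l (upd p i s)) k) (coord p i)
    (sol_dcometric p i k * (sol_metric (phi p) l l * jac phi p k l)
     + sol_cometric p k k *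
       (jac phi p i Iz * sol_dmetric (phi p) Iz l l * jac phi p k l
        + sol_metric (phi p) l l * hess phi p i k l)).
Proof.
  intros H.
  apply (is_derive_ext (fun s => sol_cometric (upd p i s) k k *
    (sol_metric (phi (upd p i s)) l l * jac phi (upd p i s) k l))).
  { intros s. symmetry. apply coord_pullback_field. }
  apply is_derive_prod3.
  - apply is_derive_sol_cometric.
  - apply is_derive_metric_along, H.
  - apply is_derive_jac, H.
  - rewrite upd_coord; auto.
Qed.

(** The covariant components of the pulled back field satisfy Killing's equation: the terms
    of the connection at phi p cancel, as d/dx and d/dy are Killing fields. The index Iz is
    excluded because d/dz is not one. *)
Lemma pullback_symmetrized_derivative phi l p i j : sol_isometry phi -> l <> Iz ->
  (jac phi p i Iz * sol_dmetric (phi p) Iz l l * jac phi p j l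
    + sol_metric (phi p) l l * hess phi p i j l)
  + (jac phi p j Iz * sol_dmetric (phi p) Iz l l * jac phi p i l
    + sol_metric (phi p) l l * hess phi p j i l)
  = 2 * sum3 (fun m => sol_christoffel p m i j * (sol_metric (phi p) l l * jac phi p m l)).
Proof.
  intros H Hl. rewrite (hess_sym phi p j i l H).
  transitivity (2 * sol_metric (phi p) l l * sum3 (fun m => sol_christoffel p m i j * jac phi p m l));
    [| unfold sum3; ring].
  rewrite <- (hess_christoffel phi p i j l H).
  destruct l; [| | now elim Hl]; unfold sum3; simpl; ring.
Qed.

(** Killing's equation for a covector w reads: the symmetrized covariant derivative
    vanishes. Raising the index gives the form with the Lie derivative. *)
Lemma killing_covariant p (w : axis3 -> R) (dw : axis3 -> axis3 -> R) :
  (forall i j, dw i j + dw j i = 2 * sum3 (fun m => sol_christoffel p m i j * w m)) ->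
  forall i j, sum3 (fun k =>
    sol_cometric p k k * w k * sol_dmetric p k i j
    + sol_metric p k j * (sol_dcometric p i k * w k + sol_cometric p k k * dw i k)
    + sol_metric p i k * (sol_dcometric p j k * w k + sol_cometric p k k * dw j k)) = 0.
Proof.
  intros Hdw i j. specialize (Hdw i j). apply Rminus_diag_eq in Hdw.
  pose proof (exp_pos (2 * coord p Iz)) as Hpos.
  pose proof (exp_opp2 (coord p Iz)) as Hinv.
  assert (Hexp : exp (- 2 * coord p Iz) = / exp (2 * coord p Iz))
    by (field_simplify_eq; lra).
  rewrite <- Hdw. destruct i, j; unfold sum3; simpl; rewrite Hexp; field; lra.
Qed.

Lemma pullback_field_killing phi l : sol_isometry phi -> l <> Iz ->
  killing_field sol_metric (pullback_field phi l).
Proof.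
  intros H Hl. split.
  - intros p i k. eexists. apply is_derive_pullback_field, H.
  - intros p i j.
    rewrite <- (killing_covariant p (fun m => sol_metric (phi p) l l * jac phi p m l)
      (fun i k => jac phi p i Iz * sol_dmetric (phi p) Iz l l * jac phi p k l
        + sol_metric (phi p) l l * hess phi p i k l)
      (fun i j => pullback_symmetrized_derivative phi l p i j H Hl) i j).
    assert (HP : forall i k, partial i (fun q => coord (pullback_field phi l q) k) p =
      sol_dcometric p i k * (sol_metric (phi p) l l * jac phi p k l)
     + sol_cometric p k k *
       (jac phi p i Iz * sol_dmetric (phi p) Iz l l * jac phi p k l
        + sol_metric (phi p) l l * hess phi p i k l)).
    { intros i0 k0. apply is_derive_unique, is_derive_pullback_field, H. }
    unfold sum3. rewrite !partial_sol_metric, !HP, !coord_pullback_field. reflexivity.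
Qed.

(** The Killing fields of SOL are spanned by d/dx, d/dy and d/dz + x d/dx - y d/dy. The
    (z, z)-equation makes the vertical component a function of (x, y); after integration in
    z, every equation is a Laurent polynomial in exp (2 z) with coefficients depending on
    (x, y), and these coefficients vanish one by one. *)
Lemma killing_fields_sol (W : R3 -> R3) : killing_field sol_metric W ->
  exists al be ga, forall x y z, W (x, y, z) = (al + ga * x, be - ga * y, ga).
Proof.
  intros [Hex Hk].
  set (V k x y z := coord (W (x, y, z)) k).
  set (P i k x y z := partial i (fun q => coord (W q) k) (x, y, z)).
  assert (Dx : forall k x y z, is_derive (fun s => V k s y z) x (P Ix k x y z))
    by (intros k x y z; apply (is_derive_partial _ (x, y, z) Ix (Hex (x, y, z) Ix k))).
  assert (Dy : forall k x y z, is_derive (fun s => V k x s z) y (P Iy k x y z))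
    by (intros k x y z; apply (is_derive_partial _ (x, y, z) Iy (Hex (x, y, z) Iy k))).
  assert (Dz : forall k x y z, is_derive (fun s => V k x y s) z (P Iz k x y z))
    by (intros k x y z; apply (is_derive_partial _ (x, y, z) Iz (Hex (x, y, z) Iz k))).
  assert (Eq : forall x y z,
    P Ix Ix x y z = V Iz x y z /\ P Iy Iy x y z = - V Iz x y z /\ P Iz Iz x y z = 0 /\
    exp (2 * z) * P Ix Iy x y z + exp (- 2 * z) * P Iy Ix x y z = 0 /\
    P Iz Ix x y z = - exp (2 * z) * P Ix Iz x y z /\
    P Iz Iy x y z = - exp (- 2 * z) * P Iy Iz x y z).
  { intros x y z.
    assert (HE : forall i j, sum3 (fun k => V k x y z * sol_dmetric (x, y, z) k i j
      + sol_metric (x, y, z) k j * P i k x y z + sol_metric (x, y, z) i k * P j k x y z) = 0).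
    { intros i j. rewrite <- (Hk (x, y, z) i j). unfold sum3.
      rewrite !partial_sol_metric. reflexivity. }
    pose proof (exp_pos (2 * z)) as Hp. pose proof (exp_pos (- 2 * z)) as Hm.
    pose proof (exp_opp2 z) as Hinv.
    pose proof (HE Ix Ix) as H1. pose proof (HE Iy Iy) as H2. pose proof (HE Iz Iz) as H3.
    pose proof (HE Ix Iy) as H4. pose proof (HE Ix Iz) as H5. pose proof (HE Iy Iz) as H6.
    clear HE. unfold sum3 in *; simpl in *.
    revert Hp Hm Hinv H1 H2 H3 H4 H5 H6.
    generalize (exp (2 * z)), (exp (- 2 * z)).
    intros p m Hp Hm Hinv H1 H2 H3 H4 H5 H6.
    repeat split.
    - apply (Rmult_eq_reg_l m); lra.
    - apply (Rmult_eq_reg_l p); lra.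
    - lra.
    - lra.
    - apply (Rmult_eq_reg_l m); [| lra].
      replace (m * (- p * P Ix Iz x y z)) with (- (p * m) * P Ix Iz x y z) by ring.
      rewrite Hinv. lra.
    - apply (Rmult_eq_reg_l p); [| lra].
      replace (p * (- m * P Iy Iz x y z)) with (- (p * m) * P Iy Iz x y z) by ring.
      rewrite Hinv. lra. }
  clear Hk.
  (* At the heights 0, z1 and - z1 the factor exp (2 z) takes the values 1, 3 and 1/3;
     three values separate the coefficients of exp (2 z), 1 and exp (- 2 z). *)
  set (z1 := / 2 * ln 3).
  assert (Ez1 : exp (2 * z1) = 3 /\ exp (- 2 * z1) = / 3 /\
      exp (2 * - z1) = / 3 /\ exp (- 2 * - z1) = 3).
  { unfold z1. replace (2 * (/ 2 * ln 3)) with (ln 3) by lra.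
    replace (- 2 * (/ 2 * ln 3)) with (- ln 3) by lra.
    replace (2 * - (/ 2 * ln 3)) with (- ln 3) by lra.
    replace (- 2 * - (/ 2 * ln 3)) with (ln 3) by lra.
    rewrite exp_Ropp, exp_ln by lra. auto. }
  destruct Ez1 as (E1 & E2 & E3 & E4).
  assert (V3 : forall x y z, V Iz x y z = V Iz x y 0).
  { intros x y z. apply (is_derive_zero_const (fun s => V Iz x y s)).
    intros t. replace 0 with (P Iz Iz x y t) by apply Eq. apply Dz. }
  set (a x y := P Ix Iz x y 0). set (b x y := P Iy Iz x y 0).
  assert (Ha : forall x y z, P Ix Iz x y z = a x y).
  { intros x y z. apply (Derive_ext (fun s => V Iz s y z) (fun s => V Iz s y 0)).
    intros t. apply V3. }
  assert (Hb : forall x y z, P Iy Iz x y z = b x y).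
  { intros x y z. apply (Derive_ext (fun s => V Iz x s z) (fun s => V Iz x s 0)).
    intros t. apply V3. }
  (* The mixed equations in (x, z) and (y, z) are now integrated in z. *)
  assert (V1 : forall x y z, V Ix x y z = V Ix x y 0 - (exp (2 * z) - 1) / 2 * a x y).
  { intros x y z.
    pose proof (is_derive_zero_const
      (fun s => V Ix x y s + (exp (2 * s) - 1) / 2 * a x y)) as Hc.
    cut (V Ix x y z + (exp (2 * z) - 1) / 2 * a x y
         = V Ix x y 0 + (exp (2 * 0) - 1) / 2 * a x y).
    { rewrite Rmult_0_r, exp_0. lra. }
    apply Hc. intros t.
    replace 0 with (P Iz Ix x y t + exp (2 * t) * a x y)
      by (rewrite <- (Ha x y t); pose proof (Eq x y t); lra).
    apply (is_derive_plus (V := R_NormedModule)); [apply Dz |].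
    auto_derive; auto; field. }
  assert (V2 : forall x y z, V Iy x y z = V Iy x y 0 + (exp (- 2 * z) - 1) / 2 * b x y).
  { intros x y z.
    pose proof (is_derive_zero_const
      (fun s => V Iy x y s + (1 - exp (- 2 * s)) / 2 * b x y)) as Hc.
    cut (V Iy x y z + (1 - exp (- 2 * z)) / 2 * b x y
         = V Iy x y 0 + (1 - exp (- 2 * 0)) / 2 * b x y).
    { rewrite Rmult_0_r, exp_0. lra. }
    apply Hc. intros t.
    replace 0 with (P Iz Iy x y t + exp (- 2 * t) * b x y)
      by (rewrite <- (Hb x y t); pose proof (Eq x y t); lra).
    apply (is_derive_plus (V := R_NormedModule)); [apply Dz |].
    auto_derive; auto; field. }
  (* The derivatives a and b of the vertical component are differences of values of W
     at two heights; hence they are differentiable in turn, although W is only assumed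
     to have first partial derivatives. *)
  assert (Ha1 : forall x y, a x y = V Ix x y 0 - V Ix x y z1)
    by (intros x y; rewrite (V1 x y z1), E1; lra).
  assert (Hb1 : forall x y, b x y = V Iy x y (- z1) - V Iy x y 0)
    by (intros x y; rewrite (V2 x y (- z1)), E4; lra).
  assert (HP1 : forall x y z, P Iy Ix x y z =
    P Iy Ix x y 0 - (exp (2 * z) - 1) / 2 * (P Iy Ix x y 0 - P Iy Ix x y z1)).
  { intros x y z. apply is_derive_unique.
    apply (is_derive_ext (fun s => V Ix x s 0
      - (exp (2 * z) - 1) / 2 * (V Ix x s 0 - V Ix x s z1))).
    { intros s. rewrite <- Ha1. symmetry. apply V1. }
    pose proof (Dy Ix x y 0) as D0. pose proof (Dy Ix x y z1) as D1.
    apply (is_derive_minus (V := R_NormedModule)); [exact D0 |].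
    apply is_derive_scal. apply (is_derive_minus (V := R_NormedModule)); assumption. }
  assert (HP2 : forall x y z, P Ix Iy x y z =
    P Ix Iy x y 0 + (exp (- 2 * z) - 1) / 2 * (P Ix Iy x y (- z1) - P Ix Iy x y 0)).
  { intros x y z. apply is_derive_unique.
    apply (is_derive_ext (fun s => V Iy s y 0
      + (exp (- 2 * z) - 1) / 2 * (V Iy s y (- z1) - V Iy s y 0))).
    { intros s. rewrite <- Hb1. symmetry. apply V2. }
    pose proof (Dx Iy x y 0) as D0. pose proof (Dx Iy x y (- z1)) as D1.
    apply (is_derive_plus (V := R_NormedModule)); [exact D0 |].
    apply is_derive_scal. apply (is_derive_minus (V := R_NormedModule)); assumption. }
  assert (Sep : forall x y,
    P Iy Ix x y 0 + (P Iy Ix x y 0 - P Iy Ix x y z1) / 2 = 0 /\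
    P Ix Iy x y 0 - (P Ix Iy x y (- z1) - P Ix Iy x y 0) / 2 = 0).
  { intros x y.
    destruct (Eq x y 0) as (_ & _ & _ & H0 & _).
    destruct (Eq x y z1) as (_ & _ & _ & H1 & _).
    destruct (Eq x y (- z1)) as (_ & _ & _ & H2 & _).
    rewrite (HP1 x y (- z1)), (HP2 x y (- z1)), E3, E4 in H2.
    rewrite (HP2 x y z1), E1, E2 in H1.
    rewrite !Rmult_0_r, exp_0 in H0. lra. }
  (* F and G are the parts of the horizontal components that do not depend on z. *)
  set (F x y := V Ix x y 0 + a x y / 2).
  set (G x y := V Iy x y 0 - b x y / 2).
  assert (Fx : forall x y, is_derive (fun s => F s y) x (V Iz x y 0)).
  { intros x y.
    apply (is_derive_ext (fun s => V Ix s y 0 + / 2 * (V Ix s y 0 - V Ix s y z1))).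
    { intros s. unfold F. rewrite Ha1. simpl. lra. }
    replace (V Iz x y 0) with (P Ix Ix x y 0 + / 2 * (P Ix Ix x y 0 - P Ix Ix x y z1)).
    2:{ rewrite (proj1 (Eq x y 0)), (proj1 (Eq x y z1)), (V3 x y z1). lra. }
    apply (is_derive_plus (V := R_NormedModule)); [apply Dx |].
    apply is_derive_scal. apply (is_derive_minus (V := R_NormedModule)); apply Dx. }
  assert (Fy : forall x y, is_derive (fun s => F x s) y 0).
  { intros x y.
    apply (is_derive_ext (fun s => V Ix x s 0 + / 2 * (V Ix x s 0 - V Ix x s z1))).
    { intros s. unfold F. rewrite Ha1. simpl. lra. }
    replace 0 with (P Iy Ix x y 0 + / 2 * (P Iy Ix x y 0 - P Iy Ix x y z1)) at 1.
    2:{ pose proof (Sep x y). lra. }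
    apply (is_derive_plus (V := R_NormedModule)); [apply Dy |].
    apply is_derive_scal. apply (is_derive_minus (V := R_NormedModule)); apply Dy. }
  assert (Gy : forall x y, is_derive (fun s => G x s) y (- V Iz x y 0)).
  { intros x y.
    apply (is_derive_ext (fun s => V Iy x s 0 - / 2 * (V Iy x s (- z1) - V Iy x s 0))).
    { intros s. unfold G. rewrite Hb1. simpl. lra. }
    replace (- V Iz x y 0)
      with (P Iy Iy x y 0 - / 2 * (P Iy Iy x y (- z1) - P Iy Iy x y 0)).
    2:{ rewrite (proj1 (proj2 (Eq x y 0))), (proj1 (proj2 (Eq x y (- z1)))), (V3 x y (- z1)). lra. }
    apply (is_derive_minus (V := R_NormedModule)); [apply Dy |].
    apply is_derive_scal. apply (is_derive_minus (V := R_NormedModule)); apply Dy. }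
  assert (Gx : forall x y, is_derive (fun s => G s y) x 0).
  { intros x y.
    apply (is_derive_ext (fun s => V Iy s y 0 - / 2 * (V Iy s y (- z1) - V Iy s y 0))).
    { intros s. unfold G. rewrite Hb1. simpl. lra. }
    replace 0 with (P Ix Iy x y 0 - / 2 * (P Ix Iy x y (- z1) - P Ix Iy x y 0)) at 1.
    2:{ pose proof (Sep x y). lra. }
    apply (is_derive_minus (V := R_NormedModule)); [apply Dx |].
    apply is_derive_scal. apply (is_derive_minus (V := R_NormedModule)); apply Dx. }
  assert (HFy : forall x y, F x y = F x 0)
    by (intros x y; exact (is_derive_zero_const (fun s => F x s) (fun t => Fy x t) y 0)).
  assert (HGx : forall x y, G x y = G 0 y)
    by (intros x y; exact (is_derive_zero_const (fun s => G s y) (fun t => Gx t y) x 0)).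
  set (ga := V Iz 0 0 0).
  (* The vertical component is both the x-derivative of F, which is free of y, and the
     opposite of the y-derivative of G, which is free of x. *)
  assert (HV3 : forall x y z, V Iz x y z = ga).
  { intros x y z. rewrite V3.
    transitivity (V Iz x 0 0).
    - rewrite <- (is_derive_unique _ _ _ (Fx x y)), <- (is_derive_unique _ _ _ (Fx x 0)).
      apply Derive_ext. intros s. apply HFy.
    - unfold ga.
      assert (Hinj : forall r s : R, - r = - s -> r = s) by (intros; lra).
      apply Hinj.
      rewrite <- (is_derive_unique _ _ _ (Gy x 0)), <- (is_derive_unique _ _ _ (Gy 0 0)).
      apply Derive_ext. intros s. apply HGx. }
  assert (Ha0 : forall x y, a x y = 0).
  { intros x y. unfold a, P, partial.
    rewrite (Derive_ext _ (fun _ => ga)) by (intros s; apply HV3). apply Derive_const. }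
  assert (Hb0 : forall x y, b x y = 0).
  { intros x y. unfold b, P, partial.
    rewrite (Derive_ext _ (fun _ => ga)) by (intros s; apply HV3). apply Derive_const. }
  exists (F 0 0), (G 0 0), ga. intros x y z.
  assert (HF : F x 0 - ga * x = F 0 0 - ga * 0).
  { apply (is_derive_zero_const (fun s => F s 0 - ga * s)). intros t.
    assert (HD : is_derive (fun s => F s 0 - ga * s) t (V Iz t 0 0 - ga * 1)).
    { apply (is_derive_minus (V := R_NormedModule)); [exact (Fx t 0) |].
      apply is_derive_scal. apply @is_derive_id. }
    rewrite HV3 in HD. replace (ga - ga * 1) with 0 in HD by ring. exact HD. }
  assert (HG : G 0 y + ga * y = G 0 0 + ga * 0).
  { apply (is_derive_zero_const (fun s => G 0 s + ga * s)). intros t.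
    assert (HD : is_derive (fun s => G 0 s + ga * s) t (- V Iz 0 t 0 + ga * 1)).
    { apply (is_derive_plus (V := R_NormedModule)); [exact (Gy 0 t) |].
      apply is_derive_scal. apply @is_derive_id. }
    rewrite HV3 in HD. replace (- ga + ga * 1) with 0 in HD by ring. exact HD. }
  pose proof (HV3 x y z) as C3. pose proof (V1 x y z) as C1. pose proof (V2 x y z) as C2.
  pose proof (HFy x y) as C4. pose proof (HGx x y) as C5.
  unfold F, G in C4, C5, HF, HG. rewrite !Ha0 in *. rewrite !Hb0 in *.
  unfold F, G. rewrite Ha0, Hb0.
  assert (C1' : V Ix x y z = V Ix 0 0 0 + 0 / 2 + ga * x) by lra.
  assert (C2' : V Iy x y z = V Iy 0 0 0 - 0 / 2 - ga * y) by lra.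
  rewrite <- C1', <- C2', <- C3. unfold V.
  destruct (W (x, y, z)) as [[w1 w2] w3]. reflexivity.
Qed.

(** * The isometries of SOL *)

(** An isometry preserves lengths, so the pulled back field has at p the length of the
    coordinate field at phi p; this length determines the height of phi p when l is not Iz. *)
Lemma pullback_field_norm phi l p : sol_isometry phi ->
  sum3 (fun i => sol_metric p i i * coord (pullback_field phi l p) i ^ 2)
  = sol_metric (phi p) l l.
Proof.
  intros H. pose proof (isometry_gram_dual phi p l l H) as Hd.
  replace (kron l l) with 1 in Hd by (destruct l; reflexivity).
  transitivity (sum3 (fun i => sol_cometric p i i * (jac phi p i l * jac phi p i l))
    * sol_metric (phi p) l l * sol_metric (phi p) l l); [| rewrite Hd; ring].
  pose proof (exp_opp2 (coord p Iz)) as He.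
  assert (Hinv : forall i, sol_metric p i i * sol_cometric p i i = 1)
    by (intros i; destruct i; simpl; lra).
  unfold sum3. rewrite !coord_pullback_field.
  transitivity (
    sol_metric p Ix Ix * sol_cometric p Ix Ix * (sol_cometric p Ix Ix * (sol_metric (phi p) l l * jac phi p Ix l)^2)
  + sol_metric p Iy Iy * sol_cometric p Iy Iy * (sol_cometric p Iy Iy * (sol_metric (phi p) l l * jac phi p Iy l)^2)
  + sol_metric p Iz Iz * sol_cometric p Iz Iz * (sol_cometric p Iz Iz * (sol_metric (phi p) l l * jac phi p Iz l)^2)).
  - ring.
  - rewrite !Hinv. ring.
Qed.

Lemma jac_of_pullback phi l p i :
  jac phi p i l = sol_metric p i i * coord (pullback_field phi l p) i
    * sol_cometric (phi p) l l.
Proof.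
  rewrite coord_pullback_field.
  assert (Hinv : forall q j, sol_metric q j j * sol_cometric q j j = 1).
  { intros q j. pose proof (exp_opp2 (coord q Iz)). destruct j; simpl; lra. }
  transitivity (sol_metric p i i * sol_cometric p i i *
    (sol_metric (phi p) l l * sol_cometric (phi p) l l) * jac phi p i l).
  - rewrite !Hinv; ring.
  - ring.
Qed.

(** The coefficients of the product are compared; the values t = 1, 2, 1/2, 3, 1/3 suffice
    because there are five of them. *)
Lemma laurent_product_one (A B C A' B' C' : R) :
  (forall t, 0 < t -> (A * / t + B * t + C) * (A' * / t + B' * t + C') = 1) ->
  A * A' = 0 /\ B * B' = 0 /\ A * C' + C * A' = 0 /\ B * C' + C * B' = 0 /\
  A * B' + B * A' + C * C' = 1.
Proof.
  intros H.
  pose proof (H 1 ltac:(lra)) as H1. pose proof (H 2 ltac:(lra)) as H2.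
  pose proof (H (/ 2) ltac:(lra)) as H3. pose proof (H 3 ltac:(lra)) as H4.
  pose proof (H (/ 3) ltac:(lra)) as H5. rewrite Rinv_inv in H3, H5. rewrite Rinv_1 in H1.
  repeat split; lra.
Qed.

Lemma affine_of_jac phi l (c : axis3 -> R) : sol_isometry phi ->
  (forall p i, jac phi p i l = c i) ->
  forall x y z, coord (phi (x, y, z)) l
    = coord (phi (0, 0, 0)) l + c Ix * x + c Iy * y + c Iz * z.
Proof.
  intros H Hc x y z.
  assert (step : forall p i s t, coord (phi (upd p i s)) l - c i * s
      = coord (phi (upd p i t)) l - c i * t).
  { intros p i.
    apply (is_derive_zero_const (fun s => coord (phi (upd p i s)) l - c i * s)).
    intros t.
    assert (HD : is_derive (fun s => coord (phi (upd p i s)) l - c i * s) t (c i - c i * 1)).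
    { apply (is_derive_minus (V := R_NormedModule)).
      - pose proof (is_derive_component phi (upd p i t) i l H) as D. rewrite Hc, coord_upd in D.
        revert D. apply is_derive_ext. intros s. rewrite upd_upd. reflexivity.
      - apply is_derive_scal. apply @is_derive_id. }
    replace (c i - c i * 1) with 0 in HD by ring. exact HD. }
  pose proof (step (x, y, z) Ix x 0) as H1. pose proof (step (0, y, z) Iy y 0) as H2.
  pose proof (step (0, 0, z) Iz z 0) as H3. simpl in H1, H2, H3. lra.
Qed.

(** The pullbacks of d/dx and d/dy are Killing fields whose squared lengths are exp (- 2 h)
    and exp (2 h), where h is the height of phi p. These are known Laurent polynomials in
    exp (2 z), and their product is 1. Hence both have a single term: one field is
    a multiple of d/dx and the other a multiple of d/dy. This determines the first
    derivatives of the horizontal components and, by the lengths, the height. *)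
Theorem sol_isometry_classification phi : sol_isometry phi ->
  exists m n x0 y0, Rabs (m * n) = 1 /\
  ((forall x y z, phi (x, y, z) = (m * x + x0, n * y + y0, z + ln (Rabs m))) \/
   (forall x y z, phi (x, y, z) = (m * y + x0, n * x + y0, ln (Rabs m) - z))).
Proof.
  intros H.
  destruct (killing_fields_sol _ (pullback_field_killing phi Ix H ltac:(discriminate)))
    as (al & be & ga & HW).
  destruct (killing_fields_sol _ (pullback_field_killing phi Iy H ltac:(discriminate)))
    as (al' & be' & ga' & HW').
  assert (N : forall x y z, exp (- 2 * z) * (al + ga * x) ^ 2 + exp (2 * z) * (be - ga * y) ^ 2
      + ga ^ 2 = exp (- 2 * coord (phi (x, y, z)) Iz)).
  { intros x y z. pose proof (pullback_field_norm phi Ix (x, y, z) H) as Hn.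
    rewrite HW in Hn. unfold sum3 in Hn; simpl in Hn. rewrite <- Hn. ring. }
  assert (N' : forall x y z, exp (- 2 * z) * (al' + ga' * x) ^ 2
      + exp (2 * z) * (be' - ga' * y) ^ 2 + ga' ^ 2 = exp (2 * coord (phi (x, y, z)) Iz)).
  { intros x y z. pose proof (pullback_field_norm phi Iy (x, y, z) H) as Hn.
    rewrite HW' in Hn. unfold sum3 in Hn; simpl in Hn. rewrite <- Hn. ring. }
  (* With t = exp (2 z), the product of the two norms is the function 1 of t. *)
  assert (L : forall x y,
    let A := (al + ga * x) ^ 2 in let B := (be - ga * y) ^ 2 in let C := ga ^ 2 in
    let A' := (al' + ga' * x) ^ 2 in let B' := (be' - ga' * y) ^ 2 in let C' := ga' ^ 2 in
    A * A' = 0 /\ B * B' = 0 /\ A * C' + C * A' = 0 /\ B * C' + C * B' = 0 /\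
    A * B' + B * A' + C * C' = 1).
  { intros x y A B C A' B' C'. apply laurent_product_one. intros t Ht.
    pose proof (N x y (/ 2 * ln t)) as E. pose proof (N' x y (/ 2 * ln t)) as E'.
    pose proof (exp_opp2 (coord (phi (x, y, / 2 * ln t)) Iz)) as Hone.
    replace (- 2 * (/ 2 * ln t)) with (- ln t) in E, E' by lra.
    replace (2 * (/ 2 * ln t)) with (ln t) in E, E' by lra.
    rewrite exp_Ropp, exp_ln in E, E' by exact Ht.
    rewrite <- Hone, <- E, <- E'. unfold A, B, C, A', B', C'. ring. }
  assert (sq0 : forall r s : R, r ^ 2 * s ^ 2 = 0 -> r = 0 \/ s = 0).
  { intros r s Hrs. apply Rmult_integral.
    assert ((r * s) * (r * s) = 0) by (rewrite <- Hrs; ring).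
    destruct (Rmult_integral _ _ H0); assumption. }
  assert (sum0 : forall r s u v : R, r ^ 2 * s ^ 2 + u ^ 2 * v ^ 2 = 0 ->
    r ^ 2 * s ^ 2 = 0 /\ u ^ 2 * v ^ 2 = 0).
  { intros r s u v Hrs. pose proof (pow2_ge_0 (r * s)). pose proof (pow2_ge_0 (u * v)).
    rewrite !Rpow_mult_distr in *. lra. }
  destruct (L 0 0) as (L1 & L2 & L3 & L4 & L5).
  destruct (L 1 0) as (_ & _ & L6 & _).
  apply sum0 in L3, L4, L6.
  destruct L3 as [L3 L3'], L4 as [L4 L4'], L6 as [L6 L6'].
  apply sq0 in L1, L2, L3, L3', L4, L4', L6, L6'.
  (* If ga were nonzero, al' + ga' x would vanish at x = 0 and x = 1, whence ga' = 0; but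
     then the last coefficient would be 0. *)
  assert (Hga : ga = 0).
  { destruct L3' as [| K1]; [assumption |]. destruct L6' as [| K2]; [assumption |].
    destruct L4' as [| K3]; [assumption |]. exfalso.
    rewrite K1, K3 in L5. assert (ga' = 0) by lra. subst ga'. lra. }
  assert (Hga' : ga' = 0).
  { destruct L3 as [K1 |]; [| assumption]. destruct L6 as [K2 |]; [| assumption].
    destruct L4 as [K3 |]; [| assumption]. exfalso.
    rewrite K1, K3, Hga in L5. lra. }
  subst ga ga'.
  replace (al + 0 * 0) with al in L1, L5 by ring.
  replace (be - 0 * 0) with be in L2, L5 by ring.
  replace (al' + 0 * 0) with al' in L1, L5 by ring.
  replace (be' - 0 * 0) with be' in L2, L5 by ring.
  assert (Hcase : al' = 0 /\ be = 0 /\ al * be' <> 0 /\ (al * be') ^ 2 = 1 \/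
                  al = 0 /\ be' = 0 /\ be * al' <> 0 /\ (be * al') ^ 2 = 1).
  { destruct L1 as [-> | ->].
    - right. destruct L2 as [-> | ->]; [exfalso; lra |].
      repeat split; auto; [intros K; apply (f_equal (fun r => r ^ 2)) in K; cbv beta in K; rewrite Rpow_mult_distr in K; lra | lra].
    - left. destruct L2 as [-> | ->]; [| exfalso; lra].
      repeat split; auto; [intros K; apply (f_equal (fun r => r ^ 2)) in K; cbv beta in K; rewrite Rpow_mult_distr in K; lra | lra]. }
  assert (abs1 : forall u v, u * v <> 0 -> (u * v) ^ 2 = 1 -> Rabs (/ u * / v) = 1).
  { intros u v Huv E. rewrite <- Rinv_mult, Rabs_inv, <- Rinv_1. f_equal.
    apply Rsqr_inj; [apply Rabs_pos | lra |]. rewrite <- Rsqr_abs. unfold Rsqr. lra. }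
  assert (J : forall p i, jac phi p i Ix = sol_metric p i i *
     coord (al, be, 0) i * exp (2 * coord (phi p) Iz)).
  { intros [[x y] z] i. rewrite jac_of_pullback, HW. simpl sol_cometric.
    replace (al + 0 * x) with al by ring. replace (be - 0 * y) with be by ring.
    reflexivity. }
  assert (J' : forall p i, jac phi p i Iy = sol_metric p i i *
     coord (al', be', 0) i * exp (- 2 * coord (phi p) Iz)).
  { intros [[x y] z] i. rewrite jac_of_pullback, HW'. simpl sol_cometric.
    replace (al' + 0 * x) with al' by ring. replace (be' - 0 * y) with be' by ring.
    reflexivity. }
  assert (height : forall u h z, u <> 0 -> exp (- 2 * h) = u ^ 2 * exp (- 2 * z) ->
    h = z + ln (Rabs (/ u))).
  { intros u h z Hu E. rewrite Rabs_inv, ln_Rinv by (apply Rabs_pos_lt, Hu).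
    assert (E1 : exp (- 2 * h) = exp (- 2 * z + 2 * ln (Rabs u))).
    { rewrite E, exp_plus. replace (2 * ln (Rabs u)) with (ln (Rabs u) + ln (Rabs u)) by ring.
      rewrite exp_plus, exp_ln by (apply Rabs_pos_lt, Hu).
      rewrite <- Rabs_mult, Rabs_pos_eq by nra. ring. }
    apply exp_inv in E1. lra. }
  assert (one : forall p, exp (2 * coord (phi p) Iz) * exp (- 2 * coord (phi p) Iz) = 1)
    by (intros; apply exp_opp2).
  assert (inv_unique : forall u v, u <> 0 -> u * v = 1 -> v = / u).
  { intros u v Hu E. apply (Rmult_eq_reg_l u); [| exact Hu]. rewrite E. field. exact Hu. }
  destruct Hcase as [(-> & -> & Hne & H1) | (-> & -> & Hne & H1)].
  - exists (/ al), (/ be'), (coord (phi (0, 0, 0)) Ix), (coord (phi (0, 0, 0)) Iy).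
    split; [now apply abs1 |]. left. intros x y z.
    assert (Hal : al <> 0) by (intros K; apply Hne; rewrite K; ring).
    assert (Hbe : be' <> 0) by (intros K; apply Hne; rewrite K; ring).
    pose proof (affine_of_jac phi Ix (fun i => match i with Ix => / al | _ => 0 end) H) as A1.
    pose proof (affine_of_jac phi Iy (fun i => match i with Iy => / be' | _ => 0 end) H) as A2.
    simpl in A1, A2.
    assert (A3 : coord (phi (x, y, z)) Iz = z + ln (Rabs (/ al))).
    { apply height; [exact Hal |]. rewrite <- (N x y z). ring. }
    rewrite <- A3. replace (/ al * x + _) with (coord (phi (x, y, z)) Ix).
    + replace (/ be' * y + _) with (coord (phi (x, y, z)) Iy).
      * destruct (phi (x, y, z)) as [[f g] h]; reflexivity.
      * rewrite A2; [lra |]. clear x y z A3. intros [[x y] z] i. rewrite J'.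
        destruct i; simpl coord; simpl sol_metric; try ring.
        apply inv_unique; [exact Hbe |]. rewrite <- (one (x, y, z)), <- (N' x y z). ring.
    + rewrite A1; [lra |]. clear x y z A3. intros [[x y] z] i. rewrite J.
      destruct i; simpl coord; simpl sol_metric; try ring.
      apply inv_unique; [exact Hal |]. rewrite <- (one (x, y, z)), <- (N x y z). ring.
  - exists (/ be), (/ al'), (coord (phi (0, 0, 0)) Ix), (coord (phi (0, 0, 0)) Iy).
    split; [now apply abs1 |]. right. intros x y z.
    assert (Hal : al' <> 0) by (intros K; apply Hne; rewrite K; ring).
    assert (Hbe : be <> 0) by (intros K; apply Hne; rewrite K; ring).
    pose proof (affine_of_jac phi Ix (fun i => match i with Iy => / be | _ => 0 end) H) as A1.
    pose proof (affine_of_jac phi Iy (fun i => match i with Ix => / al' | _ => 0 end) H) as A2.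
    simpl in A1, A2.
    assert (A3 : coord (phi (x, y, z)) Iz = ln (Rabs (/ be)) - z).
    { rewrite (height be (coord (phi (x, y, z)) Iz) (- z)); [lra | exact Hbe |].
      rewrite <- (N x y z). replace (- 2 * - z) with (2 * z) by ring. ring. }
    rewrite <- A3. replace (/ be * y + _) with (coord (phi (x, y, z)) Ix).
    + replace (/ al' * x + _) with (coord (phi (x, y, z)) Iy).
      * destruct (phi (x, y, z)) as [[f g] h]; reflexivity.
      * rewrite A2; [lra |]. clear x y z A3. intros [[x y] z] i. rewrite J'.
        destruct i; simpl coord; simpl sol_metric; try ring.
        apply inv_unique; [exact Hal |]. rewrite <- (one (x, y, z)), <- (N' x y z). ring.
    + rewrite A1; [lra |]. clear x y z A3. intros [[x y] z] i. rewrite J.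
      destruct i; simpl coord; simpl sol_metric; try ring.
      apply inv_unique; [exact Hbe |]. rewrite <- (one (x, y, z)), <- (N x y z). ring.
Qed.

(** * Isometries fixing the axis *)

Lemma differential_affine phi (A : axis3 -> axis3 -> R) (k : axis3 -> R) :
  (forall q l, coord (phi q) l = sum3 (fun i => A l i * coord q i) + k l) ->
  forall p v l, coord (Defs.differential phi p v) l = sum3 (fun i => A l i * coord v i).
Proof.
  intros HA p v l. rewrite coord_differential.
  assert (HJ : forall i, jac phi p i l = A l i).
  { intros i. apply is_derive_unique.
    apply (is_derive_ext (fun s => sum3 (fun j => A l j * coord (upd p i s) j) + k l)).
    { intros s. symmetry. apply HA. }
    destruct p as [[x y] z], i; unfold sum3; simpl; auto_derive; auto; ring. }
  unfold sum3. rewrite !HJ. reflexivity.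
Qed.

Lemma differential_diagonal phi m n x0 y0 s :
  (forall x y z, phi (x, y, z) = (m * x + x0, n * y + y0, z + s)) ->
  forall p v1 v2 v3, Defs.differential phi p (v1, v2, v3) = (m * v1, n * v2, v3).
Proof.
  intros Hphi p v1 v2 v3. apply coord_ext. intros l.
  rewrite (differential_affine phi
    (fun l i => match l, i with Ix, Ix => m | Iy, Iy => n | Iz, Iz => 1 | _, _ => 0 end)
    (fun l => match l with Ix => x0 | Iy => y0 | Iz => s end)).
  - destruct l; unfold sum3; simpl; ring.
  - intros [[x y] z] i. rewrite Hphi. destruct i; unfold sum3; simpl; ring.
Qed.

Lemma differential_antidiagonal phi m n x0 y0 s :
  (forall x y z, phi (x, y, z) = (m * y + x0, n * x + y0, s - z)) ->
  forall p v1 v2 v3, Defs.differential phi p (v1, v2, v3) = (m * v2, n * v1, - v3).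
Proof.
  intros Hphi p v1 v2 v3. apply coord_ext. intros l.
  rewrite (differential_affine phi
    (fun l i => match l, i with Ix, Iy => m | Iy, Ix => n | Iz, Iz => -1 | _, _ => 0 end)
    (fun l => match l with Ix => x0 | Iy => y0 | Iz => s end)).
  - destruct l; unfold sum3; simpl; ring.
  - intros [[x y] z] i. rewrite Hphi. destruct i; unfold sum3; simpl; ring.
Qed.

(** The image of the axis direction determines the two linear coefficients of phi up to a
    common positive factor, which is 1 because their product is 1 or -1; the image of one
    point of the axis gives the condition on x0, y0. The neutral coefficients 1 and 0 keep
    the shape that [differential_diagonal] expects. *)
Lemma isometry_fixing_axis a b c phi :
  a <> 0 -> b <> 0 -> sol_isometry phi -> fixes_axis_and_direction a b c phi ->
  exists x0 y0,
    (a * x0 - b * y0 = 0 /\ forall x y z, phi (x, y, z) = (1 * x + x0, 1 * y + y0, z + 0)) \/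
    (a * x0 - b * y0 = 2 * c /\ forall x y z,
       phi (x, y, z) = (b / a * y + x0, a / b * x + y0, 2 * grayson_h a b - z)).
Proof.
  intros Ha Hb H [Himg Hdir].
  set (p0 := (c / a, 0, grayson_h a b) : R3).
  assert (Hp0 : axis_line a b c p0) by (split; [reflexivity | field; exact Ha]).
  destruct (Hdir p0 Hp0) as (lam & Hlam & Hd).
  assert (Hq0 : axis_line a b c (phi p0)) by (apply Himg; exists p0; auto).
  clear Himg Hdir.
  assert (Hlam1 : forall m n, Rabs (m * n) = 1 -> m * n = lam * lam -> lam = 1).
  { intros m n E1 E2. rewrite E2, Rabs_pos_eq in E1 by nra. nra. }
  unfold axis_direction, vscale in Hd.
  destruct (sol_isometry_classification phi H) as (m & n & x0 & y0 & Hmn & [Hphi | Hphi]);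
    exists x0, y0; [left | right].
  - rewrite (differential_diagonal phi m n x0 y0 _ Hphi) in Hd. simpl in Hd.
    injection Hd as D1 D2 _.
    apply Rmult_eq_reg_r in D1, D2; try assumption. subst m n.
    rewrite (Hlam1 lam lam Hmn eq_refl), Rabs_R1, ln_1 in Hphi.
    split; [| exact Hphi].
    unfold p0 in Hq0. rewrite Hphi in Hq0. destruct Hq0 as [_ Hq0].
    replace (a * (1 * (c / a) + x0)) with (c + a * x0) in Hq0 by (field; exact Ha). lra.
  - rewrite (differential_antidiagonal phi m n x0 y0 _ Hphi) in Hd. simpl in Hd.
    injection Hd as D1 D2 _.
    assert (Em : m = lam * (b / a)).
    { apply (Rmult_eq_reg_r a); [| exact Ha]. rewrite D1. field. exact Ha. }
    assert (En : n = lam * (a / b)).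
    { apply (Rmult_eq_reg_r b); [| exact Hb]. rewrite D2. field. exact Hb. }
    assert (E1 : lam = 1) by (apply (Hlam1 m n Hmn); rewrite Em, En; field; auto).
    rewrite E1, Rmult_1_l in Em, En. subst m n.
    split.
    + unfold p0 in Hq0. rewrite Hphi in Hq0. destruct Hq0 as [_ Hq0].
      replace (b * (a / b * (c / a) + y0)) with (c + b * y0) in Hq0 by (field; auto). lra.
    + intros x y z. rewrite Hphi. unfold grayson_h. f_equal. lra.
Qed.

(** The offset u and the two exponential terms of the equation of the cylinder are fixed in
    the first case of [isometry_fixing_axis]; in the second one u changes sign and the
    exponential terms are exchanged. *)
Lemma isometry_preserves_grayson a b c phi :
  a <> 0 -> b <> 0 -> sol_isometry phi -> fixes_axis_and_direction a b c phi ->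
  set_eq (image phi (grayson a b c)) (grayson a b c) /\
  preserves_field phi (xi a b c) /\ preserves_field phi (eta a b).
Proof.
  intros Ha Hb H Hfix.
  assert (Hsurj : forall q, exists p, phi p = q).
  { destruct H as [(_ & psi & _ & _ & Hr) _]. intros q. exists (psi q). apply Hr. }
  destruct (isometry_fixing_axis a b c phi Ha Hb H Hfix)
    as (x0 & y0 & [[E Hphi] | [E Hphi]]); clear H Hfix.
  - assert (Hu : forall x y, a * (1 * x + x0) - b * (1 * y + y0) = a * x - b * y) by (intros; lra).
    repeat split.
    + intros ([[x y] z] & Hp & <-). rewrite Hphi. unfold grayson in *.
      rewrite Hu, Rplus_0_r. exact Hp.
    + intros Hp. destruct (Hsurj p) as [[[x y] z] <-]. eexists; split; [| reflexivity].
      rewrite Hphi in Hp. unfold grayson in *. rewrite Hu, Rplus_0_r in Hp. exact Hp.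
    + intros [[x y] z]. unfold xi at 1. rewrite (differential_diagonal _ _ _ _ _ _ Hphi), Hphi.
      unfold xi. rewrite Rplus_0_r. apply coord_ext. intros []; simpl; lra.
    + intros p. unfold eta. rewrite (differential_diagonal _ _ _ _ _ _ Hphi).
      rewrite !Rmult_1_l. reflexivity.
  - assert (Hu : forall x y, a * (b / a * y + x0) - b * (a / b * x + y0) - c
      = - (a * x - b * y - c)).
    { intros x y. transitivity (b * y - a * x + (a * x0 - b * y0) - c);
        [field; auto | rewrite E; ring]. }
    assert (E1 : forall z, a ^ 2 * exp (2 * (2 * grayson_h a b - z)) = b ^ 2 * exp (- 2 * z)).
    { intros z.
      transitivity (Rabs (a * b) * exp (2 * (grayson_h a b - z))).
      - rewrite <- (proj1 (grayson_h_balance a b _ Ha Hb)). do 2 f_equal. ring.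
      - transitivity (Rabs (a * b) * exp (- 2 * (z - grayson_h a b))); [do 2 f_equal; ring |].
        rewrite <- (proj2 (grayson_h_balance a b _ Ha Hb)). do 2 f_equal. ring. }
    assert (E2 : forall z, b ^ 2 * exp (- 2 * (2 * grayson_h a b - z)) = a ^ 2 * exp (2 * z)).
    { intros z. rewrite <- E1. do 2 f_equal. ring. }
    assert (E3 : forall x y z, grayson a b c (phi (x, y, z)) <-> grayson a b c (x, y, z)).
    { intros x y z. rewrite Hphi. unfold grayson. rewrite Hu, E1, E2.
      replace ((- (a * x - b * y - c)) ^ 2) with ((a * x - b * y - c) ^ 2) by ring.
      split; intros; lra. }
    repeat split.
    + intros ([[x y] z] & Hp & <-). apply E3, Hp.
    + intros Hp. destruct (Hsurj p) as [[[x y] z] <-]. eexists; split; [| reflexivity].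
      apply E3, Hp.
    + intros [[x y] z]. unfold xi at 1. rewrite (differential_antidiagonal _ _ _ _ _ _ Hphi), Hphi.
      unfold xi. apply coord_ext. intros []; simpl.
      * apply (Rmult_eq_reg_l a); [| exact Ha].
        transitivity (b ^ 2 * exp (- 2 * z)); [field; exact Ha | rewrite <- E1; ring].
      * apply (Rmult_eq_reg_l b); [| exact Hb].
        transitivity (a ^ 2 * exp (2 * z)); [field; exact Hb | rewrite <- E2; ring].
      * pose proof (Hu x y). lra.
    + intros p. unfold eta. rewrite (differential_antidiagonal _ _ _ _ _ _ Hphi).
      apply coord_ext. intros []; simpl; field; auto.
Qed.

(** * Geometry of Grayson cylinders *)

Theorem proposition4p9 (a b : R)
    (hab_pos : 0 < 2 * Rabs (a * b)) (hab_lt : 2 * Rabs (a * b) < 1) :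
  (* [delta] is chosen before [c]: the separation constant of (v) depends only on a, b *)
  exists delta : R, 0 < delta /\
  forall c : R,
  let G := grayson a b c in
  let X := xi a b c in
  let Y := eta a b in
  let theta := fun p => sol_angle p (X p) (Y p) in
  (* (i) *)
  (forall p, G p -> tangent_to G p (X p) /\ tangent_to G p (Y p)) /\
  (* (ii) *)
  (forall (al be : Rbar) (gam : R -> R3) (t0 : R),
     integral_curve X al be gam -> in_interval al be t0 -> G (gam t0) ->
     sol_geodesic al be gam /\ forall t, in_interval al be t -> G (gam t)) /\
  (* (iii) *)
  (forall (al be : Rbar) (gam : R -> R3) (t0 : R),
     integral_curve Y al be gam -> in_interval al be t0 -> G (gam t0) ->
     exists L : R3 -> Prop,
       horizontal_line L /\ subset L G /\ parallel_lines L (axis_line a b c) /\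
       (forall t, in_interval al be t -> L (gam t)) /\
       (al = m_infty -> be = p_infty -> set_eq (trajectory gam) L) /\
       (sol_geodesic al be gam <->
          set_eq L (inflection_line_plus a b c) \/
          set_eq L (inflection_line_minus a b c))) /\
  (* (iv) *)
  ((exists Phi, is_flow X Phi) /\ (exists Psi, is_flow Y Psi) /\
   forall Phi Psi, is_flow X Phi -> is_flow Y Psi ->
     (forall s t p, Phi s (Psi t p) = Psi t (Phi s p)) /\
     (forall t, set_eq (image (Phi t) G) G) /\
     (forall t, set_eq (image (Psi t) G) G)) /\
  (* (v) *)
  ((forall p, G p ->
      2 * Rabs (a * b) <= Rabs (cos (theta p)) /\
      Rabs (cos (theta p)) <= sqrt (2 * Rabs (a * b)) /\
      sqrt (2 * Rabs (a * b)) < 1) /\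
   (forall p, G p ->
      delta <= Rabs (theta p - 0) /\
      delta <= Rabs (theta p - PI / 2) /\
      delta <= Rabs (theta p - PI))) /\
  (* (vi) *)
  ((forall p, G p -> sign (cos (theta p)) = sign (a * b)) /\
   set_eq (fun p => G p /\
             forall q, G q -> Rabs (cos (theta p)) <= Rabs (cos (theta q)))
          (critical_lines a b c) /\
   set_eq (fun p => G p /\
             forall q, G q -> Rabs (cos (theta q)) <= Rabs (cos (theta p)))
          (inflection_lines a b c) /\
   set_eq (critical_lines a b c)
          (fun p => G p /\ a * coord p Ix - b * coord p Iy = c) /\
   set_eq (inflection_lines a b c)
          (fun p => G p /\ coord p Iz = grayson_h a b)) /\
  (* (vii) *)
  (forall phi : R3 -> R3,
     sol_isometry phi -> fixes_axis_and_direction a b c phi ->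
     set_eq (image phi G) G /\ preserves_field phi X /\ preserves_field phi Y).
Proof.
  assert (Hab : a * b <> 0) by (intros E; rewrite E, Rabs_R0 in hab_pos; lra).
  assert (Ha : a <> 0) by (intros E; apply Hab; rewrite E; ring).
  assert (Hb : b <> 0) by (intros E; apply Hab; rewrite E; ring).
  assert (Hsqrt : sqrt (2 * Rabs (a * b)) < 1)
    by (rewrite <- sqrt_1; apply sqrt_lt_1_alt; lra).
  exists (Rmin (2 * Rabs (a * b)) (1 - sqrt (2 * Rabs (a * b)))).
  split; [apply Rmin_glb_lt; lra |].
  intros c G X Y theta.
  split; [| split; [| split; [| split; [| split; [| split]]]]].
  - intros p Hp. now apply grayson_tangent.
  - intros al be gam t0 H Ht0 HG. split; [now apply (geodesic_xi a b c) |].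
    intros t Ht. apply grayson_iff_energy.
    rewrite (energy_conserved a b c al be gam t t0 H Ht Ht0). now apply grayson_iff_energy.
  - intros al be gam t0 H Ht0 HG. now apply (eta_curve_line a b c al be gam t0).
  - split; [now apply flow_xi_exists |].
    split; [exists (shift a b); apply flow_eta_exists |].
    intros Phi Psi HPhi HPsi. pose proof (flow_eta_unique a b Psi HPsi) as E.
    split; [| split].
    + intros s t p. rewrite !E. now apply (flow_xi_shift a b c).
    + intros t. now apply flow_xi_grayson.
    + intros t q. refine (iff_trans _ (shift_image_grayson a b c t q)).
      split; intros (p & Hp & Eq); exists p; (split; [exact Hp |]); rewrite <- Eq; [symmetry |]; apply E.
  - split; intros p Hp; destruct (abs_cos_angle_bounds a b c p Ha Hb hab_lt Hp) as [Hlo Hhi].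
    + auto.
    + now apply angle_separation.
  - split; [| split; [| split; [| split]]].
    + intros p Hp. now apply (sign_cos_angle a b c).
    + now apply abs_cos_angle_minimal.
    + now apply abs_cos_angle_maximal.
    + now apply critical_lines_eq.
    + now apply inflection_lines_eq.
  - intros phi Hphi Hfix. now apply isometry_preserves_grayson.
Qed.
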